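(* Let $n\ge1$ and $\mu\in\mathrm{SP}(n)$. If the transition coefficient $C^{[2]}_{(n),\mu}(t)$ is nonzero, then it is a polynomial in $t$ with nonnegative coefficients which is palindromic and unimodal.
   Context: A polynomial $f(t)$ is palindromic of darga $d$ if $f(t)=t^df(t^{-1})$ (zero coefficients at both ends of $[0,d]$ are allowed), and palindromic if this holds for some $d$. A polynomial is unimodal if its coefficient sequence is weakly increasing up to some index and weakly decreasing afterwards. A strict partition is a finite sequence $\lambda=(\lambda_1>\cdots>\lambda_\ell>0)$ of integers, with $|\lambda|=\sum\lambda_i$ and length $\ell(\lambda)=\ell$; $\mathrm{SP}(N)$ is the set of strict partitions of $N$. Let $\Gamma=\mathbb{Q}[p_1,p_3,p_5,\ldots]$ be the ring of odd power sums, graded by $\deg p_n=n$, with degree-$N$ component $\Gamma_N$. The Schur $Q$-functions $Q_\lambda\in\Gamma$ are defined as follows: $q_r$ is given by $\sum_{r\ge0}q_rz^r=\exp\bigl(2\sum_{n\ge1,\ n\text{ odd}}\frac{p_n}{n}z^n\bigr)$; for $r\ge s\ge0$ let $Q_{(r,s)}=q_rq_s+2\sum_{k=1}^{s}(-1)^kq_{r+k}q_{s-k}$; in general $Q_\lambda$ is the Pfaffian of the antisymmetric matrix with entries $Q_{(\lambda_i,\lambda_j)}$ for $i<j$, where a zero part is appended to $\lambda$ if $\ell(\lambda)$ is odd (so $Q_{(r)}=q_r$, $Q_\varnothing=1$). $\{Q_\lambda:\lambda\in\mathrm{SP}(N)\}$ is a basis of $\Gamma_N$. For indeterminates $t,s$,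 let $T_{t,s}$ be the algebra automorphism of $\Gamma$ (scalars extended to $\mathbb{Q}(t,s)$) with $T_{t,s}(p_n)=\frac{1-t^n}{1-s^n}p_n$ for $n$ odd, and define $C_{\lambda\mu}(t,s)$, $\lambda,\mu\in\mathrm{SP}(N)$, by $T_{t,s}Q_\lambda=\sum_{\mu\in\mathrm{SP}(N)}C_{\lambda\mu}(t,s)Q_\mu$. Set $C^{[2]}_{\lambda\mu}(t):=C_{\lambda\mu}(t^2,t)$. Equivalently, $Q_\lambda[X+tX]=\sum_{\mu}C^{[2]}_{\lambda\mu}(t)Q_\mu(X)$, where $f[X+tX]$ is the image of $f\in\Gamma$ under the algebra map $p_n\mapsto(1+t^n)p_n$ ($n$ odd). *)

(* Defs.v *)
From Stdlib Require Import ClassicalEpsilon.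
From HB Require Import structures.
From mathcomp Require Import all_boot all_order all_fingroup all_algebra.
From mathcomp Require Import finmap monalg.

Set Implicit Arguments.
Unset Strict Implicit.
Unset Printing Implicit Defensive.

Import Order.TTheory GRing.Theory Num.Theory.
Local Open Scope ring_scope.

Definition strict_partition_of (N : nat) (lam : seq nat) : bool :=
  [&& sorted gtn lam, all (leq 1) lam & sumn lam == N].

(* Strict partitions of N are subsequences of N, N-1, ..., 1; see mem_SP and
   uniq_SP. *)
Definition SP (N : nat) : seq (seq nat) :=
  [seq lam <- undup [seq mask (m : N.-tuple bool) (rev (iota 1 N))
                    | m <- enum {: N.-tuple bool}]
  | sumn lam == N].

Lemma uniq_SP N : uniq (SP N).
Proof. exact: filter_uniq (undup_uniq _). Qed.

Lemma mem_SP N lam : (lam \in SP N) = strict_partition_of N lam.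
Proof.
have gtnT : transitive gtn by move=> y x z /= xy yz; exact: ltn_trans yz xy.
have sN : sorted gtn (rev (iota 1 N)) by rewrite rev_sorted iota_ltn_sorted.
rewrite mem_filter mem_undup /strict_partition_of andbA [RHS]andbC.
have [sumE|//] := eqVneq (sumn lam) N; rewrite /=.
apply/mapP/andP => [[m _ ->]|[sl pl]].
  split; first by apply: sorted_mask.
  apply/allP => x /mem_mask; rewrite mem_rev mem_iota.
  by case/andP.
suff /subseqP[m sm lamE] : subseq lam (rev (iota 1 N)).
  have szm : size m == N by rewrite sm size_rev size_iota.
  by exists (Tuple szm) => //; rewrite mem_enum.
have irr : irreflexive gtn by move=> x; rewrite /= ltnn.
have asym : antisymmetric gtn.
  by move=> x y /andP[/= xy yx]; have := ltn_trans xy yx; rewrite ltnn.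
have -> : lam = [seq x <- rev (iota 1 N) | x \in lam].
  apply: (irr_sorted_eq gtnT irr) => //; first exact: sorted_filter.
  move=> x; rewrite mem_filter mem_rev mem_iota.
  case xl : (x \in lam) => //=; rewrite (allP pl _ xl) /= add1n ltnS -sumE.
  by rewrite sumnE (perm_big _ (perm_to_rem xl)) big_cons leq_addr.
exact: filter_subseq.
Qed.

(* The ring of odd power sums with scalars extended to the field K of
   characteristic 0. The variable of index i is p_{2i+1}. *)
Notation Gam K := {malg K[{cmonom nat}]}.

Section OddPowerSums.
Variable K : fieldType.

Definition podd (i : nat) : Gam K := << ucm i >>.

Definition psubst_monom (v : nat -> Gam K) (m : {cmonom nat}) : Gam K :=
  \prod_(i <- finsupp m) v i ^+ m i.

Lemma psubst_monomEw (v : nat -> Gam K) (d : {fset nat}) (m : {cmonom nat}) :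
  fsubset (finsupp m) d -> psubst_monom v m = \prod_(i <- d) v i ^+ m i.
Proof.
move=> sd; rewrite [LHS](big_fset_incl _ sd) // => i _.
by rewrite memNfinsupp => /eqP->.
Qed.

Fact psubst_monom_is_multiplicative (v : nat -> Gam K) :
  mmorphism (psubst_monom v).
Proof.
split=> [x y|]; last by rewrite /psubst_monom mdom1 big_seq_fset0.
rewrite {1}/psubst_monom mdomD.
rewrite (psubst_monomEw v (fsubsetUl _ (finsupp y))).
rewrite (psubst_monomEw v (fsubsetUr (finsupp x) _)).
by rewrite -big_split /=; apply: eq_bigr => i _; rewrite cmM exprD.
Qed.

HB.instance Definition _ (v : nat -> Gam K) :=
  isMultiplicative.Build {cmonom nat} (Gam K) (psubst_monom v)
    (psubst_monom_is_multiplicative v).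

(* The K-algebra endomorphism of Gam K sending p_{2i+1} to v i; see
   psubst_podd and psubstZ. *)
Definition psubst (v : nat -> Gam K) : {rmorphism Gam K -> Gam K} :=
  mmap (@malgC {cmonom nat} K) (psubst_monom v).

Lemma psubst_podd v i : psubst v (podd i) = v i.
Proof.
rewrite /psubst /podd /= mmapU.
rewrite -[X in X * _]/(1 : Gam K) mul1r /psubst_monom mdomU.
by rewrite big_seq_fset1 cmUU expr1.
Qed.

Lemma psubstZ v c f : psubst v (c *: f) = c *: psubst v f.
Proof. by rewrite /psubst /= mmapZ mul_malgC. Qed.

Definition Tmap (a b : K) : {rmorphism Gam K -> Gam K} :=
  psubst (fun i => ((1 - a ^+ i.*2.+1) / (1 - b ^+ i.*2.+1)) *: podd i).

(* q_r is the coefficient of z^r in exp(F), F being the sum of the terms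
   (2 / (2i+1)) p_{2i+1} z^{2i+1}. As F has no constant term, only the terms
   of F with i <= r and the powers F^k with k <= r contribute to it. *)
Definition qexponent (r : nat) : {poly Gam K} :=
  \sum_(i < r.+1) ((2 / i.*2.+1%:R : K) *: podd i) *: 'X^(i.*2.+1).

Definition qfun (r : nat) : Gam K :=
  \sum_(k < r.+1) (k`!%:R^-1 : K) *: (qexponent r ^+ k)`_r.

Definition Qpair (r s : nat) : Gam K :=
  qfun r * qfun s
  + 2 * \sum_(1 <= k < s.+1) (-1) ^+ k * (qfun (r + k) * qfun (s - k)).

Definition ord_fst m (i : 'I_m) : 'I_m.*2 :=
  Ordinal (etrans (ltn_double i m) (ltn_ord i)).

Definition ord_snd m (i : 'I_m) : 'I_m.*2 :=
  Ordinal (etrans (ltn_Sdouble i m) (ltn_ord i)).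

(* With 0-based indices the pairs are (2i, 2i+1), i < m. *)
Definition pfaffian m (A : 'M[Gam K]_(m.*2)) : Gam K :=
  ((2 ^ m * m`!)%:R^-1 : K) *:
    \sum_(sg : 'S_(m.*2))
      (-1) ^+ sg * \prod_(i < m) A (sg (ord_fst i)) (sg (ord_snd i)).

(* When the length is odd, the last index is out of bounds and nth returns the
   appended zero part. *)
Definition Qmatrix (lam : seq nat) : 'M[Gam K]_((uphalf (size lam)).*2) :=
  \matrix_(i, j)
    if (i < j)%N then Qpair (nth 0%N lam i) (nth 0%N lam j)
    else if (j < i)%N then - Qpair (nth 0%N lam j) (nth 0%N lam i)
    else 0.

Definition Qfun (lam : seq nat) : Gam K := pfaffian (Qmatrix lam).

(* C lam mu, for lam and mu in SP N, are the coefficients of T_{a,b} Q_lam on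
   the Q_mu. *)
Definition transition_coefs (N : nat) (a b : K) (C : seq nat -> seq nat -> K) :=
  forall lam, lam \in SP N ->
    Tmap a b (Qfun lam) = \sum_(mu <- SP N) C lam mu *: Qfun mu.

End OddPowerSums.

Notation Qt := {fraction {poly rat}}.

(* The inner variable is t, the outer one is s. *)
Notation Qts := {fraction {poly {poly rat}}}.

Definition var_t : Qts := tofrac ('X : {poly rat})%:P.
Definition var_s : Qts := tofrac ('X : {poly {poly rat}}).

(* P(t, s) |-> P(t^2, t) *)
Definition subst_t2_t (P : {poly {poly rat}}) : {poly rat} :=
  (map_poly (comp_poly 'X^2) P).['X].

(* v is the value of r(t, s) at (t^2, t), for r regular there. *)
Definition is_value_t2_t (r : Qts) (v : Qt) : Prop :=
  exists P D : {poly {poly rat}},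
    [/\ subst_t2_t D != 0, r = tofrac P / tofrac D
      & v = tofrac (subst_t2_t P) / tofrac (subst_t2_t D)].

Definition value_t2_t (r : Qts) : Qt :=
  epsilon (inhabits 0) (is_value_t2_t r).

Lemma value_t2_tE (P D : {poly {poly rat}}) : subst_t2_t D != 0 ->
  value_t2_t (tofrac P / tofrac D)
  = tofrac (subst_t2_t P) / tofrac (subst_t2_t D).
Proof.
move=> D0; rewrite /value_t2_t.
have [|P' [D' [D'0 eqr ->]]] :=
  epsilon_spec (inhabits 0) (is_value_t2_t (tofrac P / tofrac D)).
  by exists (tofrac (subst_t2_t P) / tofrac (subst_t2_t D)), P, D.
have subM p q : subst_t2_t (p * q) = subst_t2_t p * subst_t2_t q.
  by rewrite /subst_t2_t rmorphM hornerM.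
have nz p : subst_t2_t p != 0 -> p != 0.
  by apply: contraNneq => ->; rewrite /subst_t2_t rmorph0 horner0.
have F0 (p : {poly {poly rat}}) : subst_t2_t p != 0 -> tofrac p != 0.
  by move=> /nz; rewrite tofrac_eq0.
move/eqP: eqr; rewrite eqr_div ?F0 // -!tofracM tofrac_eq => /eqP eqPD.
apply/eqP; rewrite eqr_div ?tofrac_eq0 // -!tofracM tofrac_eq -!subM.
by rewrite eqPD.
Qed.

(* f(t) = t^d f(1/t), in Q(t) *)
Definition palindromic_of_darga (d : nat) (f : {poly rat}) : Prop :=
  let t : Qt := tofrac 'X in
  tofrac f = t ^+ d * (map_poly (fun c : rat => tofrac c%:P : Qt) f).[t^-1].

Definition palindromic (f : {poly rat}) : Prop :=
  exists d : nat, palindromic_of_darga d f.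

Definition unimodal (f : {poly rat}) : Prop :=
  exists k : nat,
    (forall i, (i < k)%N -> (i.+1 < size f)%N -> f`_i <= f`_i.+1) /\
    (forall i, (k <= i)%N -> (i.+1 < size f)%N -> f`_i.+1 <= f`_i).

(* Main.v *)
(* With C = C^[2]_{(n), mu}, multiplicativity of sum_r q_r z^r under the
   substitution gives q_n[X + tX] = sum_a t^a q_a q_{n-a}, and q_{n-b} q_b is
   Q_{(n-b,b)} + 2 sum_{i<b} Q_{(n-i,i)}, with Q_{(n/2,n/2)} = 0.  Hence C is
   t^b + 2 t^{b+1} + ... + 2 t^{n-b-1} + t^{n-b} if mu = (n-b, b) with b < n-b,
   and 0 if mu has more than two parts.

   This determines C because the Q_mu are independent.  The Pfaffian gives
   Q_mu = c q_mu + (q_kappa with larger sums of squares of parts), c <> 0, and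
   q_r^2 is itself a combination of such q_{r+k} q_{r-k}; so the |SP(n)| many
   Q_mu span all monomials of degree n in the p_i, in particular the |SP(n)|
   distinct ones that Glaisher's bijection attaches to strict partitions.
   The coefficients at these monomials then form an invertible rational matrix,
   so C(t, s) is an explicit combination of products of the fractions
   (1 - t^k) / (1 - s^k), k odd, each regular at (t^2, t). *)

From HB Require Import structures.
Require Import Defs.
From mathcomp Require Import all_boot all_order all_fingroup all_algebra.
From mathcomp Require Import finmap monalg.
From mathcomp Require Import zify ring.

Set Implicit Arguments.
Unset Strict Implicit.
Unset Printing Implicit Defensive.

Import Order.TTheory GRing.Theory Num.Theory.
Local Open Scope ring_scope.

(** * Coefficients and change of scalars *)

(* Both are sealed: unification would unfold the representation of malg. *)
HB.lock Definition gmon (K : fieldType) (m : {cmonom nat}) : Gam K := << m >>.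

HB.lock Definition gcoef (K : fieldType) (m : {cmonom nat}) (f : Gam K) : K :=
  f@_m.

Section Monomials.
Variable K : fieldType.
Local Notation X := (gmon K).

Lemma gcoef_gmon (k m : {cmonom nat}) : gcoef m (X k) = (k == m)%:R.
Proof. rewrite gmon.unlock gcoef.unlock; exact: mcoeffU. Qed.

Fact gcoef_is_zmod_morphism m : zmod_morphism (@gcoef K m).
Proof. move=> f g; rewrite gcoef.unlock; exact: mcoeffB. Qed.

HB.instance Definition _ m :=
  GRing.isZmodMorphism.Build (Gam K) K (@gcoef K m) (gcoef_is_zmod_morphism m).

Lemma gcoefZ m (c : K) (f : Gam K) : gcoef m (c *: f) = c * gcoef m f.
Proof. rewrite gcoef.unlock; exact: mcoeffZ. Qed.

Lemma gcoef_sum (I : Type) (s : seq I) (P : pred I) (F : I -> Gam K) m :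
  gcoef m (\sum_(i <- s | P i) F i) = \sum_(i <- s | P i) gcoef m (F i).
Proof. exact: raddf_sum. Qed.

Lemma gcoefP (f g : Gam K) : (forall m, gcoef m f = gcoef m g) -> f = g.
Proof. by rewrite gcoef.unlock => E; apply/malgP. Qed.

Lemma gmonM (k m : {cmonom nat}) : X (mmul k m) = X k * X m.
Proof.
by rewrite gmon.unlock; apply/esym/(etrans (fgmulUU _ _ _ _)); rewrite mulr1.
Qed.

Lemma gmon1 : X mone = 1.
Proof. by rewrite gmon.unlock. Qed.

Lemma podd_gmon i : podd K i = X (ucm i).
Proof. by rewrite gmon.unlock. Qed.

Lemma gmonE (f : Gam K) : f = \sum_(k <- msupp f) gcoef k f *: X k.
Proof.
rewrite [LHS]monalgE; apply: eq_bigr => k _; apply: gcoefP => m.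
rewrite gcoefZ gcoef_gmon mulr_natr gcoef.unlock; exact: mcoeffU.
Qed.

Lemma psubst_scale v (c : K) (f : Gam K) : psubst v (c *: f) = c *: psubst v f.
Proof. exact: psubstZ. Qed.

Lemma psubst_gmon v k : psubst v (X k) = psubst_monom v k.
Proof.
rewrite gmon.unlock /psubst /=; apply: etrans (mmapU _ _) _.
exact: mul1r.
Qed.

Lemma gmon_prod (I : Type) (s : seq I) (F : I -> {cmonom nat}) :
  X (\big[mmul/mone]_(i <- s) F i) = \prod_(i <- s) X (F i).
Proof.
elim: s => [|i s IH]; first by rewrite !big_nil gmon1.
by rewrite !big_cons gmonM IH.
Qed.

Lemma gmon_iter (i e : nat) :
  X (iter e (mmul (ucm i)) mone) = podd K i ^+ e.
Proof.
rewrite podd_gmon; elim: e => [|e IH]; first by rewrite gmon1.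
by rewrite iterS gmonM IH exprS.
Qed.

Lemma iter_ucmE (i e j : nat) :
  (iter e (mmul (ucm i)) mone : {cmonom nat}) j = ((i == j) * e)%N.
Proof.
elim: e => [|e IH] /=; first by rewrite cm1 muln0.
by rewrite cmM IH cmU mulnS.
Qed.

Lemma cm_bigE (I : Type) (s : seq I) (F : I -> {cmonom nat}) j :
  (\big[mmul/mone]_(i <- s) F i : {cmonom nat}) j = (\sum_(i <- s) F i j)%N.
Proof.
elim: s => [|i s IH]; first by rewrite !big_nil cm1.
by rewrite !big_cons cmM IH.
Qed.

Lemma cmonom_prod (m : {cmonom nat}) :
  m = \big[mmul/mone]_(i <- finsupp m) iter (m i) (mmul (ucm i)) mone.
Proof.
apply/eqP/cmP => j; rewrite cm_bigE.
under eq_bigr do rewrite iter_ucmE.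
have [jm|jm] := boolP (j \in finsupp m).
  rewrite (big_rem j) //= eqxx mul1n big_seq big1 ?addn0 // => i.
  by rewrite mem_rem_uniq ?fset_uniq // inE; case/andP=> /negPf->.
rewrite big_seq big1 => [|i im].
  by move: jm; rewrite -cmE_eq0 => /eqP->.
by case: eqP => // ij; rewrite -ij im in jm.
Qed.

Lemma gmon_podd m : X m = \prod_(i <- finsupp m) podd K i ^+ m i.
Proof.
rewrite [in LHS](cmonom_prod m) gmon_prod.
by apply: eq_bigr => i _; rewrite gmon_iter.
Qed.

Lemma psubst_monom_scale (x : nat -> K) m :
  psubst_monom (fun i => x i *: podd K i) m =
  (\prod_(i <- finsupp m) x i ^+ m i) *: X m.
Proof.
rewrite gmon_podd -scaler_prod /psubst_monom.
by apply: eq_bigr => i _; rewrite exprZn.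
Qed.

(** Rescaling the variables acts diagonally on monomials. This makes the coefficients of
    $T_{a,b}Q_\lambda$ explicit. *)
Lemma gcoef_psubst_scale (x : nat -> K) (f : Gam K) (m : {cmonom nat}) :
  gcoef m (psubst (fun i => x i *: podd K i) f)
  = gcoef m f * \prod_(i <- finsupp m) x i ^+ m i.
Proof.
rewrite [in LHS](gmonE f) [f in X in _ = X]gmonE rmorph_sum !gcoef_sum.
rewrite mulr_suml.
apply: eq_bigr => k _; rewrite psubst_scale psubst_gmon psubst_monom_scale.
apply: (etrans (gcoefZ _ _ _)).
apply: (etrans (congr1 _ (gcoefZ _ _ _))).
apply: (etrans _ (esym (congr1 (fun z => z * _) (gcoefZ _ _ _)))).
move: (gcoef k f) => c; rewrite gcoef_gmon -mulrA; congr (_ * _).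
by case: eqP => [->|_]; rewrite ?mulr1 ?mul1r // mul0r mulr0.
Qed.

End Monomials.

Section BaseChange.
Variables (k K : fieldType) (h : {rmorphism k -> K}).

Definition base_change : {rmorphism Gam k -> Gam K} :=
  mmap (@malgC {cmonom nat} K \o h) (psubst_monom (@podd K)).

Local Notation bc := base_change.

Lemma base_change_gmon m : bc (gmon k m) = gmon K m.
Proof.
rewrite (gmon_podd K) gmon.unlock.
by apply: etrans (mmapU _ _) _; rewrite /= !rmorph1 mul1r.
Qed.

Lemma base_changeZ (c : k) (f : Gam k) : bc (c *: f) = h c *: bc f.
Proof. by rewrite /base_change /= mmapZ mul_malgC. Qed.

Lemma gcoef_base_change (f : Gam k) m : gcoef m (bc f) = h (gcoef m f).
Proof.
rewrite [in LHS](gmonE f) [f in X in _ = X]gmonE rmorph_sum !gcoef_sum.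
rewrite rmorph_sum.
apply: eq_bigr => l _; rewrite base_changeZ base_change_gmon.
rewrite !gcoefZ.
by rewrite rmorphM !gcoef_gmon rmorph_nat.
Qed.

Lemma base_change_podd i : bc (podd k i) = podd K i.
Proof. by rewrite !podd_gmon base_change_gmon. Qed.

End BaseChange.

(** * Q-functions of a sequence in an algebra *)

Section QFunctions.
Variables (K : fieldType) (A : comAlgType K).
Implicit Types (x q : nat -> A) (lam : seq nat).

(** The constructions of $q_r$ and $Q_\lambda$ are repeated here for any sequence [x] in a
    commutative algebra, so that ring morphisms can transport them. At [podd K] they are the
    original ones by conversion. *)
Definition exponent x (r : nat) : {poly A} :=
  \sum_(i < r.+1) ((2 / i.*2.+1%:R : K) *: x i) *: 'X^(i.*2.+1).

Definition qseq x (r : nat) : A :=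
  \sum_(k < r.+1) (k`!%:R^-1 : K) *: (exponent x r ^+ k)`_r.

Definition qpair q (r s : nat) : A :=
  q r * q s + 2 * \sum_(1 <= k < s.+1) (-1) ^+ k * (q (r + k)%N * q (s - k)%N).

Definition pfaff m (M : 'M[A]_(m.*2)) : A :=
  ((2 ^ m * m`!)%:R^-1 : K) *:
    \sum_(sg : 'S_(m.*2))
      (-1) ^+ sg * \prod_(i < m) M (sg (ord_fst i)) (sg (ord_snd i)).

Definition qmatrix q lam : 'M[A]_((uphalf (size lam)).*2) :=
  \matrix_(i, j)
    if (i < j)%N then qpair q (nth 0%N lam i) (nth 0%N lam j)
    else if (j < i)%N then - qpair q (nth 0%N lam j) (nth 0%N lam i)
    else 0.

Definition qpf q lam : A := pfaff (qmatrix q lam).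

End QFunctions.

Lemma qfunE (K : fieldType) r : qfun K r = qseq (podd K) r.
Proof. by []. Qed.

Lemma QfunE (K : fieldType) lam : Qfun K lam = qpf (qfun K) lam.
Proof. by []. Qed.

Section QFunctionsMorphism.
Variables (k K : fieldType) (h : {rmorphism k -> K}).
Variables (A : comAlgType k) (B : comAlgType K) (g : {rmorphism A -> B}).
Hypothesis gZ : forall c f, g (c *: f) = h c *: g f.

Lemma rmorph_exponent x r : map_poly g (exponent x r) = exponent (g \o x) r.
Proof.
rewrite /exponent rmorph_sum; apply: eq_bigr => i _ /=.
by rewrite map_polyZ map_polyXn gZ fmorph_div !rmorph_nat.
Qed.

Lemma rmorph_qseq x r : g (qseq x r) = qseq (g \o x) r.
Proof.
rewrite /qseq rmorph_sum; apply: eq_bigr => j _.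
by rewrite gZ fmorphV rmorph_nat -rmorph_exponent -rmorphXn coef_map.
Qed.

Lemma rmorph_qpair q r s : g (qpair q r s) = qpair (g \o q) r s.
Proof.
rewrite /qpair rmorphD !rmorphM rmorph_sum rmorph_nat.
congr (_ + _ * _); apply: eq_bigr => i _.
by rewrite !rmorphM rmorphXn rmorphN1.
Qed.

Lemma rmorph_qpf q lam : g (qpf q lam) = qpf (g \o q) lam.
Proof.
rewrite /qpf /pfaff gZ fmorphV rmorph_nat; congr (_ *: _).
rewrite rmorph_sum; apply: eq_bigr => sg _.
rewrite rmorphM rmorphXn rmorphN1 rmorph_prod; congr (_ * _).
apply: eq_bigr => i _; rewrite !mxE.
by case: ifP => _; [|case: ifP => _]; rewrite ?rmorphN ?rmorph0 ?rmorph_qpair.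
Qed.

End QFunctionsMorphism.

Section QFunctionsBaseChange.
Variables (k K : fieldType) (h : {rmorphism k -> K}).

Lemma eq_qpf (F : fieldType) (A : comAlgType F) (q q' : nat -> A) lam :
  q =1 q' -> qpf q lam = qpf q' lam.
Proof.
move=> E; have Eqpair r s : qpair q r s = qpair q' r s.
  by rewrite /qpair !E; congr (_ + _ * _); apply: eq_bigr => i _; rewrite !E.
rewrite /qpf /pfaff; congr (_ *: _); apply: eq_bigr => sg _; congr (_ * _).
by apply: eq_bigr => i _; rewrite !mxE !Eqpair.
Qed.

Lemma eq_qseq (F : fieldType) (A : comAlgType F) (x x' : nat -> A) r :
  x =1 x' -> qseq x r = qseq x' r.
Proof.
move=> E; have Ee : exponent x r = exponent x' r.
  by rewrite /exponent; apply: eq_bigr => i _; rewrite E.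
by rewrite /qseq Ee.
Qed.

(** All scalars in the construction are rational. With [k] the rationals, the coefficients of
    [Qfun K lam] are thus images of rational numbers, whatever [K] is. *)
Lemma base_change_Qfun lam : base_change h (Qfun k lam) = Qfun K lam.
Proof.
rewrite !QfunE (rmorph_qpf (base_changeZ h)); apply: eq_qpf => r /=.
rewrite !qfunE (rmorph_qseq (base_changeZ h)).
by apply: eq_qseq => i; apply: base_change_podd.
Qed.

End QFunctionsBaseChange.

(** * Newton's identities *)

Section Newton.
Variables (K : fieldType) (A : comAlgType K).
Hypothesis K0 : [pchar K] =i pred0.
Variable x : nat -> A.

Let nz n : n.+1%:R != 0 :> K.
Proof. by rewrite ((pcharf0P K).1 K0). Qed.

Lemma alg_mulrIn n : injective (fun a : A => a *+ n.+1).
Proof.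
move=> a b /= E; apply: (scalerI (nz n)).
by rewrite !scaler_nat.
Qed.

(* The logarithmic derivative of sum_r q_r z^r is sum_j (dlog j) z^j. *)
Definition dlog (j : nat) : A := if odd j then 0 else x j./2 *+ 2.

Lemma coef_exponent r j :
  (exponent x r)`_j
  = if odd j && (j./2 <= r)%N then (2 / j%:R : K) *: x j./2 else 0.
Proof.
rewrite /exponent coef_sum; case: ifP => [/andP[oj jr]|H].
  have jE : (j./2).*2.+1 = j by rewrite -[RHS]odd_double_half oj.
  rewrite (bigD1 (Ordinal (jr : (j./2 < r.+1)%N))) //= coefZ coefXn jE eqxx mulr1.
  rewrite big1 ?addr0 // => i /eqP ij; rewrite coefZ coefXn.
  case: eqP => [E|_]; last by rewrite mulr0.
  by case: ij; apply/val_inj; rewrite /= E /= uphalf_double.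
rewrite big1 // => i _; rewrite coefZ coefXn.
case: eqP => [E|_]; last by rewrite mulr0.
by move: H; rewrite E /= odd_double /= uphalf_double -ltnS ltn_ord.
Qed.

Lemma coef_exponent_le r s j : (j <= r)%N -> (j <= s)%N ->
  (exponent x r)`_j = (exponent x s)`_j.
Proof.
move=> jr js; rewrite !coef_exponent; congr (if _ && _ then _ else _).
lia.
Qed.

Lemma coef_exponentX_le r s k j : (j <= r)%N -> (j <= s)%N ->
  (exponent x r ^+ k)`_j = (exponent x s ^+ k)`_j.
Proof.
elim: k j => [|k IH] j jr js; first by rewrite !expr0.
rewrite !exprS !coefM; apply: eq_bigr => -[i /= ij] _.
by rewrite (coef_exponent_le (s := s)) ?IH //; lia.
Qed.

Lemma coef_exponentX0 r k j : (j < k)%N -> (exponent x r ^+ k)`_j = 0.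
Proof.
elim: k j => [|k IH] j // jk; rewrite exprS coefM big1 // => -[[|i] /= ij] _.
  by rewrite coef_exponent mul0r.
by rewrite IH ?mulr0 //; lia.
Qed.

(** The truncation order does not affect the coefficient: $F^k$ starts in degree at least $k$, and
    its coefficients up to $m$ depend only on those of $F$ up to $m$. One polynomial then serves for
    all $q_m$ with $m\le r$. *)
Lemma qseq_le r m : (m <= r)%N ->
  qseq x m = \sum_(k < r.+1) (k`!%:R^-1 : K) *: (exponent x r ^+ k)`_m.
Proof.
move=> mr; rewrite /qseq -(subnKC mr); move: (r - m)%N => d.
rewrite -[in RHS]addSn big_split_ord /= [X in _ = _ + X]big1 ?addr0 => [|k _].
  apply: eq_bigr => k _; rewrite (coef_exponentX_le (s := (m + d)%N)) //; lia.
by rewrite coef_exponentX0 ?scaler0 //= ltn_addr.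
Qed.

Lemma qseq0 : qseq x 0 = 1.
Proof.
by rewrite /qseq big_ord_recl big_ord0 expr0 coef1 fact0 invr1 scale1r addr0.
Qed.

(** The coefficient of $z^r$ in $(e^F)'=F'e^F$. *)
Lemma qseq_newton r :
  qseq x r.+1 *+ r.+1 = \sum_(j < r.+1) dlog j * qseq x (r - j).
Proof.
rewrite {1}/qseq big_ord_recl expr0 coef1 /= scaler0 add0r.
rewrite -sumrMnl.
(* The constant term of the exponential is gone. In the others, $(F^{k+1})'=(k+1)F'F^k$ turns
   $1/(k+1)!$ into $1/k!$. *)
transitivity (\sum_(k < r.+1) (k`!%:R^-1 : K) *:
   ((exponent x r.+1)^`() * exponent x r.+1 ^+ k)`_r).
  apply: eq_bigr => k _; rewrite /bump /= add1n scalerMnr -coef_deriv.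
  rewrite deriv_exp /= coefMn -scaler_nat scalerA factS natrM invfM.
  by rewrite mulrAC mulVf ?nz ?mul1r // mulrC.
transitivity (\sum_(k < r.+1) \sum_(j < r.+1) (k`!%:R^-1 : K) *:
    ((exponent x r.+1)^`()`_j * (exponent x r.+1 ^+ k)`_(r - j))).
  by apply: eq_bigr => k _; rewrite coefM scaler_sumr.
rewrite exchange_big /=; apply: eq_bigr => -[j /= jr] _.
rewrite (qseq_le (r := r)) ?leq_subr // mulr_sumr; apply: eq_bigr => k _.
rewrite scalerAr (coef_exponentX_le (s := r)) ?leq_subr //; try lia.
congr (_ * _); rewrite coef_deriv coef_exponent /dlog /=.
case: (boolP (odd j)) => oj //=; first by rewrite mul0rn.
have -> : (uphalf j <= r.+1)%N by lia.
rewrite -scaler_nat scalerA mulrCA mulfV ?nz // mulr1 scaler_nat.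
by rewrite uphalf_half (negPf oj).
Qed.

End Newton.

Section Recursion.
Variables (K : fieldType) (A : comAlgType K).
Hypothesis K0 : [pchar K] =i pred0.
Implicit Types d e u v : nat -> A.

(** The differential equation $U'=DU$ between generating series, read coefficientwise. *)
Definition newton_rec d u :=
  forall r, u r.+1 *+ r.+1 = \sum_(j < r.+1) d j * u (r - j)%N.

Lemma newton_rec_uniq d u v :
  newton_rec d u -> newton_rec d v -> u 0 = v 0 -> u =1 v.
Proof.
move=> du dv uv0 r; elim/ltn_ind: r => -[//|r] IH.
apply: (alg_mulrIn K0 (n := r)); rewrite /= du dv.
by apply: eq_bigr => j _; rewrite IH // ltnS leq_subr.
Qed.

Definition convol u v r := \sum_(a < r.+1) u a * v (r - a)%N.

(** The product rule: logarithmic derivatives add up when series are multiplied. *)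
Lemma newton_rec_convol d e u v : newton_rec d u -> newton_rec e v ->
  newton_rec (fun j => d j + e j) (convol u v).
Proof.
move=> du ev r.
(* Degree $r+1$ must be kept, since the coefficient of $z^r$ in a derivative comes from it. *)
pose tr w : {poly A} := \poly_(i < r.+2) w i.
have trE w i : (i <= r.+1)%N -> (tr w)`_i = w i.
  by move=> ir; rewrite coef_poly ltnS ir.
have coefUV p q m : (m <= r.+1)%N -> (tr p * tr q)`_m = convol p q m.
  move=> mr; rewrite coefM; apply: eq_bigr => -[i /= im] _.
  by rewrite !trE //; lia.
have dtr c w i : newton_rec c w -> (i <= r)%N -> (tr w)^`()`_i = (tr c * tr w)`_i.
  move=> cw ir; rewrite coef_deriv trE ?ltnS // cw coefUV; last by lia.
  by [].
have dM c w w' : newton_rec c w ->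
    ((tr w)^`() * tr w')`_r = \sum_(j < r.+1) c j * convol w w' (r - j)%N.
  move=> cw; transitivity ((tr c * (tr w * tr w'))`_r).
    rewrite mulrA !coefM; apply: eq_bigr => -[i /= ir] _.
    by rewrite (dtr c) //.
  rewrite coefM; apply: eq_bigr => -[i /= ir] _.
  by rewrite coefUV ?trE //; lia.
have convC w w' m : convol w w' m = convol w' w m.
  rewrite /convol (reindex_inj rev_ord_inj); apply: eq_bigr => -[i /= im] _.
  by rewrite subSS mulrC subKn.
rewrite -coefUV // -coef_deriv derivM coefD (dM d) //.
rewrite (mulrC (tr u)) (dM e) // -big_split /=; apply: eq_bigr => j _.
by rewrite (convC v) mulrDl.
Qed.

End Recursion.

(** * Products of two one-row functions *)

Section Products.
Variables (K : fieldType) (A : comAlgType K).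
Hypothesis K0 : [pchar K] =i pred0.
Variable x : nat -> A.
Local Notation q := (qseq x).

(** The coefficient of $z^r$ in $Q(cz)Q(z)$, where $Q(z)=\sum_r q_rz^r$. *)
Definition qgeom (c : K) r := \sum_(a < r.+1) c ^+ a *: (q a * q (r - a)%N).

Lemma newton_rec_qgeom c :
  newton_rec (fun j => (1 + c ^+ j.+1) *: dlog x j) (qgeom c).
Proof.
have qr := qseq_newton K0 x : newton_rec _ q.
have cqr : newton_rec (fun j => c ^+ j.+1 *: dlog x j) (fun r => c ^+ r *: q r).
  move=> r; rewrite scalerMnr qr scaler_sumr; apply: eq_bigr => -[j /= jr] _.
  by rewrite -scalerAl -scalerAr scalerA -exprD; congr (c ^+ _ *: _); lia.
move=> r; have := newton_rec_convol cqr qr r.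
rewrite /convol; under eq_bigr => a _ do rewrite -scalerAl.
move=> ->; apply: eq_bigr => j _; rewrite [1 + _]addrC scalerDl scale1r.
by congr (_ * _); apply: eq_bigr => a _; rewrite -scalerAl.
Qed.

Lemma qgeom0 c : qgeom c 0 = 1.
Proof. by rewrite /qgeom big_ord_recl big_ord0 qseq0 mulr1 addr0 scale1r. Qed.

(** Both sides start at 1 and satisfy the same Newton recursion, as [g] multiplies [dlog x j] by
    $1+c^{j+1}$. *)
Lemma rmorph_qseq_qgeom (g : {rmorphism A -> A}) c :
  (forall i, g (x i) = (1 + c ^+ i.*2.+1) *: x i) ->
  forall r, g (q r) = qgeom c r.
Proof.
move=> gx; apply: (newton_rec_uniq K0 (d := fun j => (1 + c ^+ j.+1) *: dlog x j)).
- move=> r; rewrite -rmorphMn (qseq_newton K0) rmorph_sum.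
  apply: eq_bigr => j _; rewrite rmorphM; congr (_ * _); rewrite /dlog.
  case: ifP => oj; rewrite ?rmorph0 ?scaler0 // rmorphMn gx scalerMnr.
  by have -> : (j./2.*2 = j)%N by move: oj; lia.
- exact: newton_rec_qgeom.
- by rewrite qseq0 rmorph1 qgeom0.
Qed.

(** This is $Q(z)Q(-z)=1$. At $c=-1$ the factor $1+c^{j+1}$ vanishes for even $j$ and [dlog x j] for
    odd $j$. *)
Lemma qseq_alternating r :
  \sum_(a < r.+2) (-1) ^+ a * (q a * q (r.+1 - a)%N) = 0.
Proof.
have E : qgeom (-1) r.+1 = \sum_(a < r.+2) (-1) ^+ a * (q a * q (r.+1 - a)%N).
  apply: eq_bigr => a _.
  by rewrite -(signr_odd K) -(signr_odd A) scaler_sign mulr_sign.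
rewrite -E; apply: (alg_mulrIn K0 (n := r)); rewrite /= newton_rec_qgeom mul0rn.
rewrite big1 // => j _; rewrite /dlog; case: ifP => oj.
  by rewrite scaler0 mul0r.
by rewrite -(signr_odd K) /= oj expr1 subrr scale0r mul0r.
Qed.

Lemma qpairE n b : (b <= n)%N -> qpair q (n - b) b =
  q (n - b)%N * q b
  + 2 * \sum_(k < b) (-1) ^+ k.+1 * (q (n - (b - k.+1))%N * q (b - k.+1)%N).
Proof.
move=> bn; rewrite /qpair big_add1 /= big_mkord; congr (_ + _ * _).
by apply: eq_bigr => -[k /= kb] _; congr (_ * (q _ * _)); lia.
Qed.

(** In the alternating relation of degree $2m$ the terms $a<m$ and $a>m$ mirror each other, so its
    left side is $(-1)^mQ_{(m,m)}$. *)
Lemma qpair_diag m : (0 < m)%N -> qpair q m m = 0.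
Proof.
case: m => // m _; pose n := (m.+1).*2.
have -> : qpair q m.+1 m.+1 = qpair q (n - m.+1) m.+1 by congr (qpair _ _ _); lia.
rewrite qpairE; last by lia.
have := qseq_alternating (m.*2.+1).
have -> : (m.*2.+3 = m.+1 + (1 + m.+1))%N by lia.
rewrite big_split_ord big_split_ord big_ord1 /= addn0.
rewrite (reindex_inj rev_ord_inj) /=.
set S := \sum_(k < m.+1) _; set S' := \sum_(k < m.+1) _.
set T := \sum_(k < m.+1) _.
have ST : S = (-1) ^+ m.+1 * T.
  rewrite mulr_sumr; apply: eq_bigr => -[k /= km] _; rewrite mulrA -exprD.
  rewrite -signr_odd -[in RHS]signr_odd; congr ((-1) ^+ _ * _); first by lia.
  by rewrite mulrC; congr (q _ * q _); lia.
have S'T : S' = (-1) ^+ m.+1 * T.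
  rewrite mulr_sumr; apply: eq_bigr => -[k /= km] _; rewrite mulrA -exprD.
  rewrite -signr_odd -[in RHS]signr_odd; congr ((-1) ^+ _ * _); first by lia.
  by congr (q _ * q _); lia.
rewrite ST S'T.
have -> : (n - m.+1 = m.+1)%N by lia.
move=> E; apply: (can_inj (signrMK m.+1)); rewrite mulr0 -[RHS]E; ring.
Qed.

(** The two alternating sums have opposite signs and cancel, except for the first term
    $-2q_{n-b}q_b$ of the longer one. *)
Lemma qpair_step n b : (b < n)%N ->
  qpair q (n - b.+1) b.+1 + qpair q (n - b) b
  = q (n - b.+1)%N * q b.+1 - q (n - b)%N * q b.
Proof.
move=> bn; rewrite !qpairE //; last by lia.
rewrite big_ord_recl /= subSS subn0 expr1.
rewrite [X in 2 * (_ + X)](_ : _ = - \sum_(k < b) (-1) ^+ k.+1 *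
   (q (n - (b - k.+1))%N * q (b - k.+1)%N)); first by ring.
rewrite -sumrN; apply: eq_bigr => k _; rewrite /bump /= add1n subSS.
by rewrite [in LHS]exprS mulN1r mulNr.
Qed.

(** The coefficient 1, 2 or 0 of $Q_{(n-b,b)}$ in $q_{n-m}q_m$, according as $b=m$, $b<m$ or
    $b>m$. *)
Definition qmult (b m : nat) : nat := (b == m) + (b < m).*2.

(** Induction by [qpair_step]: passing from $m$ to $m+1$ adds $Q_{(n-m-1,m+1)}$ and raises the
    multiplicity of $Q_{(n-m,m)}$ from 1 to 2. *)
Lemma mul_qseqE n m : (m <= n)%N ->
  q (n - m)%N * q m = \sum_(b < m.+1) qpair q (n - b) b *+ qmult b m.
Proof.
elim: m => [_|m IH mn].
  by rewrite big_ord1 /qmult /= mulr1n /qpair big_geq // mulr0 addr0.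
have -> : q (n - m.+1)%N * q m.+1 = q (n - m)%N * q m
   + (qpair q (n - m.+1) m.+1 + qpair q (n - m) m).
  by rewrite qpair_step // addrC subrK.
rewrite IH ?(ltnW mn) // big_ord_recr [in RHS]big_ord_recr [in RHS]big_ord_recr /=.
rewrite /qmult eqxx ltnn ltnSn eqn_leq ltnn andbF /=.
rewrite (eq_bigr (fun b : 'I_m => qpair q (n - b) b *+ 2)); last first.
  move=> [b /= bm] _.
  by congr (_ *+ _); lia.
rewrite [in RHS](eq_bigr (fun b : 'I_m => qpair q (n - b) b *+ 2)); last first.
  move=> [b /= bm] _.
  by congr (_ *+ _); lia.
by rewrite eqxx ltnn !addn0 add0n !mulr1n mulr2n; ring.
Qed.

Lemma qgeomE c n : (0 < n)%N -> qgeom c n =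
  \sum_(b < n.+1 | (b.*2 < n)%N)
    (\sum_(a < n.+1) c ^+ a *+ qmult b (minn a (n - a))) *: qpair q (n - b) b.
Proof.
move=> n0; under eq_bigr => b _ do rewrite scaler_suml.
rewrite exchange_big /=; apply: eq_bigr => -[a /= an] _.
under eq_bigr => b _ do rewrite -scalerMnl scalerMnr.
rewrite -scaler_sumr; congr (_ *: _).
have -> : q a * q (n - a)%N = q (n - minn a (n - a))%N * q (minn a (n - a)).
  case: (leqP a (n - a)%N) => _; first by rewrite mulrC.
  by congr (q _ * _); lia.
set m := minn _ _; have m2 : (m.*2 <= n)%N by rewrite /m; lia.
rewrite mul_qseqE; last by lia.
have mn : (m.+1 <= n.+1)%N by lia.
rewrite (big_ord_widen n.+1 (fun b => qpair q (n - b) b *+ qmult b m)) //.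
rewrite big_mkcond [RHS]big_mkcond /=; apply: eq_bigr => -[b /= bn] _.
(* If $b\le m$ but $2b\ge n$, then $2m\le n$ forces $n=2b$, and the term is $Q_{(b,b)}=0$ with
   $b>0$. *)
case: (ltnP b m.+1) => bm; case: (ltnP b.*2 n) => b2 //.
  have -> : (n - b = b)%N by lia.
  by rewrite qpair_diag ?mul0rn //; lia.
by rewrite (_ : qmult b m = 0%N) ?mulr0n // /qmult; lia.
Qed.

End Products.

(** * The Pfaffian of the sign matrix *)

Section SignPfaffian.
Variables (R : numDomainType) (m : nat).
Local Notation T := 'I_(m.*2).
Implicit Types (x y : T) (i j k : 'I_m) (sg : {perm T}).

Definition ord_sign (n : nat) (x y : 'I_n) : R :=
  if (x < y)%N then 1 else if (y < x)%N then - 1 else 0.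

(** Summed over [sg], this is $2^mm!$ times the Pfaffian of the matrix with all entries 1 above the
    diagonal. That Pfaffian is the factor of $q_\lambda$ in the leading part of $Q_\lambda$. *)
Definition sign_term sg : R :=
  (-1) ^+ sg * \prod_(i < m) ord_sign (sg (ord_fst i)) (sg (ord_snd i)).

(** Here [sg] stands for the perfect matching with pairs $\{sg(2i),sg(2i+1)\}$, and the block
    $\{2k,2k+1\}$ is to be one of them. *)
Definition matched k sg :=
  [exists i, ((sg (ord_fst i))./2 == k) && ((sg (ord_snd i))./2 == k)].

Definition swap_pair k : {perm T} := tperm (ord_fst k) (ord_snd k).

Definition swap_blocks i k : {perm T} :=
  (tperm (ord_fst i) (ord_fst k) * tperm (ord_snd i) (ord_snd k))%g.

Lemma ord_fst_half i : (ord_fst i)./2 = i. Proof. exact: doubleK. Qed.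
Lemma ord_snd_half i : (ord_snd i)./2 = i. Proof. exact: uphalf_double. Qed.

Lemma ord_fst_inj : injective (@ord_fst m).
Proof.
by move=> i j E; apply: val_inj; rewrite /= -ord_fst_half E ord_fst_half.
Qed.
Lemma ord_snd_inj : injective (@ord_snd m).
Proof.
by move=> i j E; apply: val_inj; rewrite /= -ord_snd_half E ord_snd_half.
Qed.

Lemma ord_fst_snd i j : (ord_fst i == ord_snd j) = false.
Proof. by apply/eqP => /(congr1 val) /=; lia. Qed.

Lemma ord_snd_fst i j : (ord_snd i == ord_fst j) = false.
Proof. by rewrite eq_sym ord_fst_snd. Qed.

Lemma ord_pairP x : exists i, x = ord_fst i \/ x = ord_snd i.
Proof.
have xm : (x./2 < m)%N by case: x => x /=; lia.
exists (Ordinal xm); have := odd_double_half x.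
case: (odd x) => E; [right|left]; apply: val_inj; rewrite /= -[LHS]E; lia.
Qed.

Lemma ord_half_pair k x : x./2 = k -> x = ord_fst k \/ x = ord_snd k.
Proof.
have [i [->|->]] := ord_pairP x; rewrite ?ord_fst_half ?ord_snd_half.
  by move=> /val_inj->; left.
by move=> /val_inj->; right.
Qed.

Lemma odd_swap_pair k : odd_perm (swap_pair k).
Proof. by rewrite odd_tperm ord_fst_snd. Qed.

Lemma odd_swap_blocks i k : odd_perm (swap_blocks i k) = false.
Proof.
by rewrite odd_permM !odd_tperm (inj_eq ord_fst_inj) (inj_eq ord_snd_inj) addbb.
Qed.

Lemma swap_pair_half k x : (swap_pair k x)./2 = x./2.
Proof. by rewrite /swap_pair; case: tpermP => [->|->|] //=; lia. Qed.

Lemma swap_pair_fst i j :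
  swap_pair i (ord_fst j) = if j == i then ord_snd i else ord_fst j.
Proof.
case: (eqVneq j i) => [->|ji]; first by rewrite /swap_pair tpermL.
by rewrite /swap_pair tpermD ?ord_snd_fst // (inj_eq ord_fst_inj) eq_sym.
Qed.

Lemma swap_pair_snd i j :
  swap_pair i (ord_snd j) = if j == i then ord_fst i else ord_snd j.
Proof.
case: (eqVneq j i) => [->|ji]; first by rewrite /swap_pair tpermR.
by rewrite /swap_pair tpermD ?ord_fst_snd // (inj_eq ord_snd_inj) eq_sym.
Qed.

Lemma swap_blocks_fst i k j : swap_blocks i k (ord_fst j) = ord_fst (tperm i k j).
Proof.
rewrite permM -(inj_tperm _ _ _ ord_fst_inj).
by rewrite [LHS]tpermD ?ord_snd_fst.
Qed.

Lemma swap_blocks_snd i k j : swap_blocks i k (ord_snd j) = ord_snd (tperm i k j).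
Proof.
rewrite permM (@tpermD _ (ord_fst i) (ord_fst k)) ?ord_fst_snd //.
exact/esym/inj_tperm/ord_snd_inj.
Qed.

Lemma ord_signC (n : nat) (x y : 'I_n) : ord_sign x y = - ord_sign y x.
Proof. by rewrite /ord_sign; case: ltngtP; rewrite ?opprK ?oppr0. Qed.

(** The indices $2k$ and $2k+1$ are adjacent, so exchanging them preserves every comparison except
    the one between themselves. *)
Lemma ord_sign_swap_pair k x y : x != y -> ~~ ((x./2 == k) && (y./2 == k)) ->
  ord_sign (swap_pair k x) (swap_pair k y) = ord_sign x y.
Proof.
suff lt_swap (u v : T) : u != v -> ~~ ((u./2 == k) && (v./2 == k)) ->
    (swap_pair k u < swap_pair k v)%N = (u < v)%N.
  move=> xy nk; have yx : y != x by rewrite eq_sym.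
  by rewrite /ord_sign !lt_swap // andbC.
rewrite /swap_pair; case: tpermP => [->|->|/eqP u1 /eqP u2];
  case: tpermP => [->|->|/eqP v1 /eqP v2]; rewrite ?eqxx //=.
all: try move: u1 u2; try move: v1 v2; rewrite -?val_eqE /=; lia.
Qed.

(* Hence the permutations that do not match 2k with 2k+1 cancel in pairs. *)
Lemma sign_term_swap_pairR k sg : ~~ matched k sg ->
  sign_term (sg * swap_pair k)%g = - sign_term sg.
Proof.
move/existsPn => nk; rewrite /sign_term odd_permM odd_swap_pair addbT signrN.
rewrite mulNr; congr (- (_ * _)); apply: eq_bigr => i _.
by rewrite !permM ord_sign_swap_pair // (inj_eq perm_inj) ord_fst_snd.
Qed.

Lemma matched_swap_pairR j k sg : matched j (sg * swap_pair k)%g = matched j sg.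
Proof. by apply: eq_existsb => i; rewrite !permM !swap_pair_half. Qed.

(** The sign of the transposition cancels against the antisymmetry of the factor of pair [i]. *)
Lemma sign_term_swap_pairL i sg : sign_term (swap_pair i * sg)%g = sign_term sg.
Proof.
rewrite /sign_term odd_permM odd_swap_pair addTb signrN mulNr -mulrN.
congr (_ * _); rewrite (bigD1 i) // [in RHS](bigD1 i) //= !permM.
rewrite swap_pair_fst swap_pair_snd eqxx ord_signC mulNr opprK; congr (_ * _).
apply: eq_bigr => j /negPf ji.
by rewrite !permM swap_pair_fst swap_pair_snd ji.
Qed.

Lemma matched_swap_pairL i j sg : matched j sg -> matched j (swap_pair i * sg)%g.
Proof.
case/existsP => l /andP[l1 l2]; apply/existsP; exists l.
rewrite !permM swap_pair_fst swap_pair_snd.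
by case: (eqVneq l i) => [<-|_]; rewrite l1 l2.
Qed.

(** The permutation is even and only reorders the factors. *)
Lemma sign_term_swap_blocks i k sg :
  sign_term (swap_blocks i k * sg)%g = sign_term sg.
Proof.
rewrite /sign_term odd_permM odd_swap_blocks addFb; congr (_ * _).
rewrite [RHS](reindex_inj (@perm_inj _ (tperm i k))); apply: eq_bigr => j _.
by rewrite !(permM (swap_blocks _ _)) swap_blocks_fst swap_blocks_snd.
Qed.

Lemma matched_swap_blocks i k j sg :
  matched j sg -> matched j (swap_blocks i k * sg)%g.
Proof.
case/existsP => l El; apply/existsP; exists (tperm i k l).
by rewrite !(permM (swap_blocks _ _)) swap_blocks_fst swap_blocks_snd tpermK.
Qed.

(** Swaps within and between pairs leave the term unchanged and bring [sg] to the identity, one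
    block at a time. *)
Lemma sign_term_matched sg : (forall j, matched j sg) -> sign_term sg = 1.
Proof.
(* The first $k$ blocks are already fixed pointwise; $d$ blocks remain. *)
suff H d (k : nat) sg' : (k + d = m)%N -> (forall j, matched j sg') ->
    (forall i, (i < k)%N ->
       sg' (ord_fst i) = ord_fst i /\ sg' (ord_snd i) = ord_snd i) ->
    sign_term sg' = 1 by move=> ms; apply: (H m 0%N).
elim: d k sg' => [|d IH] k {}sg km msg fix_sg.
  have -> : sg = 1%g.
    apply/permP => x; rewrite perm1; have [i [->|->]] := ord_pairP x;
      by have [] := fix_sg i _; first by rewrite -(addn0 k) km.
  rewrite /sign_term odd_perm1 expr0 mul1r big1 // => i _.
  by rewrite !perm1 /ord_sign /= ltnSn.
have k_m : (k < m)%N by lia.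
pose k' := Ordinal k_m.
(* It suffices to treat a pair [i] sent to block $k$ in increasing order: otherwise, swap inside the
   pair first. *)
suff Hi i sg' : (k <= i)%N -> (forall j, matched j sg') ->
    (forall j, (j < k)%N ->
       sg' (ord_fst j) = ord_fst j /\ sg' (ord_snd j) = ord_snd j) ->
    sg' (ord_fst i) = ord_fst k' -> sg' (ord_snd i) = ord_snd k' ->
    sign_term sg' = 1.
  have /existsP[i /andP[/eqP i1 /eqP i2]] := msg k'.
  have ki : (k <= i)%N.
    rewrite leqNgt; apply/negP => ik; have [E _] := fix_sg i ik.
    by move: i1; rewrite E ord_fst_half /=; lia.
  have ne : sg (ord_fst i) != sg (ord_snd i).
    by rewrite (inj_eq perm_inj) ord_fst_snd.
  have [E1|E1] := ord_half_pair i1; have [E2|E2] := ord_half_pair i2;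
    try by rewrite E1 E2 eqxx in ne.
    exact: (Hi i sg).
  rewrite -(sign_term_swap_pairL i); apply: (Hi i) => //.
  - by move=> j; apply: matched_swap_pairL.
  - move=> j jk; rewrite !permM swap_pair_fst swap_pair_snd.
    have -> : (j == i) = false by apply/eqP => E; move: jk ki; rewrite E; lia.
    exact: fix_sg.
  - by rewrite permM swap_pair_fst eqxx.
  - by rewrite permM swap_pair_snd eqxx.
move=> ki {}msg {}fix_sg E1 E2.
rewrite -(sign_term_swap_blocks i k'); apply: (IH k.+1); first by lia.
  by move=> j; apply: matched_swap_blocks.
move=> j jk; rewrite !(permM (swap_blocks _ _)) swap_blocks_fst swap_blocks_snd.
have [->|jk'] := eqVneq j k'; first by rewrite tpermR.
have {}jk : (j < k)%N by move: jk' jk; rewrite -val_eqE /=; lia.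
rewrite tpermD 1?eq_sym //; first exact: fix_sg.
by apply/eqP => E; move: jk ki; rewrite E; lia.
Qed.

(** Permutations leaving some block unmatched cancel, one block being treated after the other. The
    remaining terms are all 1, and the identity is among them. *)
Lemma sum_sign_term_neq0 : \sum_sg sign_term sg != 0.
Proof.
have H (k : nat) : (k <= m)%N -> \sum_sg sign_term sg =
    \sum_(sg | [forall j : 'I_m, (j < k)%N ==> matched j sg]) sign_term sg.
  elim: k => [|k IH] km.
    by apply: eq_bigl => sg; apply/esym/forallP.
  rewrite (IH (ltnW km)) (bigID (matched (Ordinal km))) /=.
  (* Right multiplication by [swap_pair] preserves the index set of [U] and negates its terms. *)
  set U := (X in _ + X = _); have U0 : U = 0.
    have /eqP : U = - U.
      rewrite {1}/U (reindex_inj (mulIg (swap_pair (Ordinal km)))) /= -sumrN.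
      rewrite (eq_bigl (fun sg => [forall j : 'I_m, (j < k)%N ==> matched j sg] &&
         ~~ matched (Ordinal km) sg)) => [|sg]; last first.
        rewrite matched_swap_pairR; congr (_ && _).
        by apply: eq_forallb => j; rewrite matched_swap_pairR.
      by apply: eq_bigr => sg /andP[_]; apply: sign_term_swap_pairR.
    by rewrite -addr_eq0 -mulr2n mulrn_eq0 => /eqP.
  rewrite U0 addr0; apply: eq_bigl => sg.
  apply/andP/forallP => [[/forallP Hk mk] j|Hk].
    apply/implyP; rewrite ltnS leq_eqVlt => /orP[/eqP jk|/(implyP (Hk j))//].
    by rewrite (_ : j = Ordinal km) //; apply: val_inj.
  split; last by have := Hk (Ordinal km); rewrite ltnSn.
  by apply/forallP => j; apply/implyP => jk; apply: (implyP (Hk j)); lia.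
rewrite (H m) // (eq_bigr (fun=> 1)) => [|sg /forallP Hs]; last first.
  by apply: sign_term_matched => j; apply: (implyP (Hs j)).
rewrite sumr_const pnatr_eq0 -lt0n; apply/card_gt0P; exists 1%g.
apply/forallP => j; apply/implyP => _; apply/existsP; exists j.
by rewrite !perm1 ord_fst_half ord_snd_half !eqxx.
Qed.

End SignPfaffian.

(** * Spanning *)

Lemma big_ord_pairs (S : Type) (idx : S) (op : Monoid.law idx) m
    (G : 'I_(m.*2) -> S) :
  \big[op/idx]_x G x = \big[op/idx]_(i < m) op (G (ord_fst i)) (G (ord_snd i)).
Proof.
pose G' n := oapp G idx (insub n).
have G'E x : G' (val x) = G x by rewrite /G' valK.
transitivity (\big[op/idx]_(x < m.*2) G' x).
  by apply: eq_bigr => x _; rewrite G'E.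
transitivity (\big[op/idx]_(i < m) op (G' i.*2) (G' i.*2.+1)); last first.
  by apply: eq_bigr => i _; rewrite -!G'E.
elim: m {G G'E} G' => [|m IH] G'; first by rewrite !big_ord0.
by rewrite doubleS !big_ord_recr /= IH Monoid.mulmA.
Qed.

(** Indices past the end read the default part 0, which [F] sends to the unit. *)
Lemma big_nth_pad (S : Type) (idx : S) (op : Monoid.law idx)
    (F : nat -> S) n lam :
  F 0%N = idx -> (size lam <= n)%N ->
  \big[op/idx]_(i < n) F (nth 0%N lam i) = \big[op/idx]_(r <- lam) F r.
Proof.
move=> F0; elim: lam n => [|a lam IH] [|n] //= sn; first by rewrite big_ord0 big_nil.
  by rewrite big_nil big1 // => i _; rewrite nth_nil F0.
by rewrite big_ord_recl big_cons /= -(IH n).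
Qed.

Lemma perm_dup (T : eqType) (s : seq T) :
  ~~ uniq s -> exists r s', perm_eq s (r :: r :: s').
Proof.
elim: s => [//|a s IH] /=; rewrite negb_and negbK.
case: (boolP (a \in s)) => [as_ _|_ /IH[r [s' ss']]].
  by exists a, (rem a s); rewrite perm_cons perm_to_rem.
exists r, (a :: s'); rewrite (perm_trans (y := a :: r :: r :: s')) ?perm_cons //.
by rewrite (perm_catCA [:: a] [:: r; r] s').
Qed.

Definition sumsq (s : seq nat) : nat := (\sum_(r <- s) r ^ 2)%N.

(** The filtration by sums of squares is therefore finite in each degree. *)
Lemma sumsq_le s : (sumsq s <= sumn s ^ 2)%N.
Proof.
rewrite /sumsq; elim: s => [|a s IH]; first by rewrite big_nil.
rewrite big_cons /=; move: IH; nia.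
Qed.

Section Span.
Variables (K : numFieldType) (A : comAlgType K).
Variable x : nat -> A.
Local Notation q := (qseq x).
Let K0 : [pchar K] =i pred0 := pchar_num K.

Definition qprod (s : seq nat) : A := \prod_(r <- s) q r.

(* The span of the q_s with |s| = d and sum of squares of parts at least e. *)
Inductive qspan (d e : nat) : A -> Prop :=
| qspan0 : qspan d e 0
| qspan_cons c s f : sumn s = d -> (e <= sumsq s)%N -> qspan d e f ->
    qspan d e (c *: qprod s + f).

Lemma qspan_qprod s e : (e <= sumsq s)%N -> qspan (sumn s) e (qprod s).
Proof.
by move=> es; rewrite -[qprod s]scale1r -[_ *: _]addr0; do 2?constructor.
Qed.

Lemma qspanD d e f g : qspan d e f -> qspan d e g -> qspan d e (f + g).
Proof.
by move=> + Hg; elim=> [|c s h sd es _ IH]; rewrite ?add0r // -addrA; constructor.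
Qed.

Lemma qspanZ d e c f : qspan d e f -> qspan d e (c *: f).
Proof.
elim=> [|c' s h sd es _ IH]; rewrite ?scaler0; first by constructor.
by rewrite scalerDr scalerA; constructor.
Qed.

Lemma qspanN d e f : qspan d e f -> qspan d e (- f).
Proof. by rewrite -scaleN1r; apply: qspanZ. Qed.

Lemma qspanB d e f g : qspan d e f -> qspan d e g -> qspan d e (f - g).
Proof. by move=> Hf /qspanN; apply: qspanD. Qed.

Lemma qspanMn d e f n : qspan d e f -> qspan d e (f *+ n).
Proof. by rewrite -scaler_nat; apply: qspanZ. Qed.

Lemma qspan_sum d e (I : Type) (s : seq I) (P : pred I) (F : I -> A) :
  (forall i, P i -> qspan d e (F i)) -> qspan d e (\sum_(i <- s | P i) F i).
Proof. by move=> H; apply: big_ind => //; [constructor | apply: qspanD]. Qed.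

Lemma qspanW d e e' f : (e' <= e)%N -> qspan d e f -> qspan d e' f.
Proof.
move=> ee'; elim=> [|c s h sd es _ IH]; constructor => //; exact: leq_trans es.
Qed.

Lemma qprod_cat s t : qprod (s ++ t) = qprod s * qprod t.
Proof. exact: big_cat. Qed.

Lemma perm_qprod s t : perm_eq s t -> qprod s = qprod t.
Proof. exact: perm_big. Qed.

Lemma sumsq_cat s t : sumsq (s ++ t) = (sumsq s + sumsq t)%N.
Proof. exact: big_cat. Qed.

Lemma qspanM d e d' e' f g :
  qspan d e f -> qspan d' e' g -> qspan (d + d')%N (e + e')%N (f * g).
Proof.
move=> Hf Hg; elim: Hf => [|c s h sd es _ IH]; first by rewrite mul0r; constructor.
rewrite mulrDl; apply: qspanD => //; rewrite -scalerAl; apply: qspanZ.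
elim: Hg => [|c' s' h' sd' es' _ IH']; first by rewrite mulr0; constructor.
rewrite mulrDr; apply: qspanD => //; rewrite -scalerAr; apply: qspanZ.
rewrite -qprod_cat -sd -sd' -sumn_cat; apply: qspan_qprod.
by rewrite sumsq_cat leq_add.
Qed.

Lemma qspan1 : qspan 0%N 0%N 1.
Proof.
rewrite (_ : 1 = qprod [::]); last by rewrite /qprod big_nil.
exact: (@qspan_qprod [::] 0%N).
Qed.

(* f has leading term u for the filtration by the sum of squares. *)
Definition leading d e (u f : A) := qspan d e u /\ qspan d e.+1 (f - u).

Lemma leadingM d e d' e' u v f g : leading d e u f -> leading d' e' v g ->
  leading (d + d')%N (e + e')%N (u * v) (f * g).
Proof.
move=> [Hu Hf] [Hv Hg]; split; first exact: qspanM.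
(* The factor $v+(g-v)$ is [g], split to show that it has level at least [e']. *)
rewrite (_ : _ - _ = (f - u) * (v + (g - v)) + u * (g - v)); last by ring.
apply: qspanD; last by rewrite -addnS; apply: qspanM.
rewrite -addSn; apply: qspanM => //; apply: qspanD => //.
exact: qspanW (leqnSn _) _.
Qed.

Lemma leading_prod (I : Type) (r : seq I) (d e : I -> nat) (u f : I -> A) :
  (forall i, leading (d i) (e i) (u i) (f i)) ->
  leading (\sum_(i <- r) d i)%N (\sum_(i <- r) e i)%N
    (\prod_(i <- r) u i) (\prod_(i <- r) f i).
Proof.
move=> H; elim: r => [|i r IH]; last by rewrite !big_cons; apply: leadingM.
by rewrite !big_nil; split; [exact: qspan1 | rewrite subrr; constructor].
Qed.

Lemma leadingZ d e c u f : leading d e u f -> leading d e (c *: u) (c *: f).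
Proof. by case=> Hu Hf; split; rewrite -?scalerBr; apply: qspanZ. Qed.

Lemma leading_sum d e (I : finType) (u f : I -> A) :
  (forall i, leading d e (u i) (f i)) ->
  leading d e (\sum_i u i) (\sum_i f i).
Proof.
move=> H; split; rewrite -?sumrB; apply: qspan_sum => i _; by case: (H i).
Qed.

Lemma qprod2 r s : qprod [:: r; s] = q r * q s.
Proof. by rewrite /qprod big_cons big_seq1. Qed.

Lemma sumsq2 r s : sumsq [:: r; s] = (r ^ 2 + s ^ 2)%N.
Proof. by rewrite /sumsq big_cons big_seq1. Qed.

Lemma qspan_q2 r s e : (e <= r ^ 2 + s ^ 2)%N -> qspan (r + s)%N e (q r * q s).
Proof.
by rewrite -qprod2 -sumsq2 => /qspan_qprod; rewrite /= addn0.
Qed.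

(** Replacing $(r,s)$ by $(r+k,s-k)$ increases the sum of squares by $2k(r-s+k)>0$. *)
Lemma leading_qpair r s : (s <= r)%N ->
  leading (r + s)%N (r ^ 2 + s ^ 2)%N (q r * q s) (qpair q r s).
Proof.
move=> sr; split; first exact: qspan_q2.
rewrite /qpair addrAC subrr add0r mulr_natl; apply: qspanMn.
rewrite big_nat; apply: qspan_sum => k /andP[k0 ks].
rewrite -signr_odd mulr_sign.
have H : qspan (r + s)%N (r ^ 2 + s ^ 2).+1%N (q (r + k)%N * q (s - k)%N).
  rewrite (_ : (r + s = (r + k) + (s - k))%N); last by lia.
  apply: qspan_q2; have : (k <= s)%N by [].
  move=> /subnKC; move: (s - k)%N sr => j + sE; rewrite -{s ks}sE.
  by move=> /subnKC <-; rewrite !expnS !expn0 !muln1; nia.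
by case: ifP => _ //; apply: qspanN.
Qed.

Lemma leading_qmatrix lam (i j : 'I_(uphalf (size lam)).*2) :
  sorted gtn lam -> i != j ->
  let li := nth 0%N lam i in let lj := nth 0%N lam j in
  leading (li + lj)%N (li ^ 2 + lj ^ 2)%N (ord_sign K i j *: (q li * q lj))
    (qmatrix q lam i j).
Proof.
move=> sl; have le_nth a b : (a < b)%N -> (nth 0 lam b <= nth 0 lam a)%N.
  move=> ab; case: (ltnP b (size lam)) => bl; last by rewrite nth_default.
  apply/ltnW/(sorted_ltn_nth (leT := gtn)) => //; last exact: ltn_trans bl.
  by move=> y z w /= zy yw; apply: ltn_trans yw zy.
move=> ij li lj; rewrite mxE /ord_sign.
case: (ltngtP i j) => ij'; last by rewrite (val_inj ij') eqxx in ij.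
  by rewrite scale1r; apply: leading_qpair; apply: le_nth.
rewrite addnC [X in leading _ X]addnC [q _ * _]mulrC.
rewrite -[X in leading _ _ _ X]scaleN1r.
by apply: leadingZ; apply: leading_qpair; apply: le_nth.
Qed.

(** In each term of the Pfaffian every index occurs once, so all terms have leading monomial
    $q_\lambda$ up to sign. The signs add up to the nonzero Pfaffian of the sign matrix. *)
Lemma leading_qpf lam : sorted gtn lam ->
  exists2 c : K, c != 0 &
    leading (sumn lam) (sumsq lam) (c *: qprod lam) (qpf q lam).
Proof.
move=> sl; set m := uphalf (size lam).
exists ((2 ^ m * m`!)%:R^-1 * \sum_sg @sign_term K m sg).
  rewrite mulf_neq0 ?sum_sign_term_neq0 // invr_eq0 pnatr_eq0 muln_eq0.
  by rewrite expn_eq0 /= -lt0n fact_gt0.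
rewrite -scalerA scaler_suml /qpf /pfaff -/m.
apply: leadingZ; apply: leading_sum => sg; rewrite /sign_term -scalerA.
have sm : (size lam <= m.*2)%N by rewrite /m; lia.
suff H : leading (sumn lam) (sumsq lam)
   ((\prod_(i < m) ord_sign K (sg (ord_fst i)) (sg (ord_snd i))) *: qprod lam)
   (\prod_(i < m) qmatrix q lam (sg (ord_fst i)) (sg (ord_snd i))).
  rewrite mulr_sign scaler_sign; case: ifP => _ //.
  by rewrite -!(scaleN1r (_ : A)); apply: leadingZ.
pose l (y : 'I_(m.*2)) := nth 0%N lam (sg y).
(* Any operation over the parts can be regrouped along the pairs of [sg]; this is applied to
   degrees, sums of squares and products. A padded zero contributes the unit, as $q_0=1$. *)
have bigE (S : Type) (idx : S) (op : Monoid.com_law idx) (F : nat -> S) :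
    F 0%N = idx ->
    \big[op/idx]_(r <- lam) F r =
    \big[op/idx]_(i < m) op (F (l (ord_fst i))) (F (l (ord_snd i))).
  move=> F0; rewrite -(big_nth_pad _ F0 sm) (reindex_inj (@perm_inj _ sg)) /=.
  exact: (big_ord_pairs op (fun y => F (l y))).
rewrite sumnE /sumsq /qprod (bigE _ _ _ (fun r => r)) //.
rewrite (bigE _ _ _ (fun r => r ^ 2)%N) // (bigE _ _ _ q) ?qseq0 //.
rewrite -scaler_prod; apply: leading_prod => i; apply: leading_qmatrix => //.
by rewrite (inj_eq perm_inj) ord_fst_snd.
Qed.

Definition Qspan n (f : A) :=
  exists c : seq nat -> K, f = \sum_(mu <- SP n) c mu *: qpf q mu.

Lemma Qspan0 n : Qspan n 0.
Proof. by exists (fun=> 0); rewrite big1 // => mu _; rewrite scale0r. Qed.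

Lemma QspanD n f g : Qspan n f -> Qspan n g -> Qspan n (f + g).
Proof.
move=> [c ->] [d ->]; exists (fun mu => c mu + d mu); rewrite -big_split.
by apply: eq_bigr => mu _; rewrite scalerDl.
Qed.

Lemma QspanZ n a f : Qspan n f -> Qspan n (a *: f).
Proof.
move=> [c ->]; exists (fun mu => a * c mu); rewrite scaler_sumr.
by apply: eq_bigr => mu _; rewrite scalerA.
Qed.

Lemma Qspan_qpf n mu : mu \in SP n -> Qspan n (qpf q mu).
Proof.
move=> mun; exists (fun nu => (nu == mu)%:R); rewrite (bigD1_seq mu) ?uniq_SP //=.
rewrite eqxx scale1r big1 ?addr0 // => nu /negPf->; exact: scale0r.
Qed.

(** Descending induction on the level: each $q_s$ is a multiple of some $Q_\mu$ modulo higher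
    levels, or lies itself in a higher level. *)
Lemma qspan_Qspan n e f : qspan n e f -> Qspan n f.
Proof.
suff H k : forall e f, (n ^ 2 < e + k)%N -> qspan n e f -> Qspan n f.
  by apply: (H (n ^ 2).+1); rewrite addnS ltnS leq_addl.
elim: k => [|k IH] {}e {}f ne.
  elim=> [|c s h sd es _ _]; first exact: Qspan0.
  by have := sumsq_le s; rewrite sd; lia.
elim=> [|c s h sd es _ Hh]; first exact: Qspan0.
apply: QspanD => //; apply: QspanZ => {c h Hh}.
have {}IH g : qspan n e.+1 g -> Qspan n g by apply: IH; lia.
(* Zero parts change neither the product nor the two sums, so they are dropped. *)
pose s' := sort geq [seq r <- s | (0 < r)%N].
have bigE (S : Type) (idx : S) (op : Monoid.com_law idx) (F : nat -> S) :
    F 0%N = idx -> \big[op/idx]_(r <- s) F r = \big[op/idx]_(r <- s') F r.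
  move=> F0; rewrite [RHS](perm_big [seq r <- s | (0 < r)%N]) ?perm_sort //=.
  rewrite big_filter [RHS]big_mkcond; apply: eq_bigr => -[|r] _ //.
have sd' : sumn s' = n by rewrite sumnE -bigE // -sumnE.
have es' : (e <= sumsq s')%N by rewrite /sumsq -bigE.
rewrite /qprod bigE ?qseq0 // -/(qprod s').
have [us|/perm_dup[r [t st]]] := boolP (uniq s'); last first.
  have r0 : (0 < r)%N.
    have : r \in s' by rewrite (perm_mem st) mem_head.
    by rewrite mem_sort mem_filter => /andP[].
  rewrite (perm_qprod st) -[r :: r :: t]/([:: r; r] ++ t) qprod_cat qprod2.
  apply: IH; apply: (qspanW (e := (r ^ 2 + r ^ 2).+1 + sumsq t)%N).
    move: es'; rewrite /sumsq (perm_big _ st) !big_cons /=; lia.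
  have -> : n = ((r + r) + sumn t)%N.
    by rewrite -sd' !sumnE (perm_big _ st) !big_cons /= addnA.
  apply: qspanM; last exact: qspan_qprod.
  (* Since $Q_{(r,r)}=0$, its leading term $q_r^2$ is a combination of terms of higher level. *)
  have [_] := leading_qpair (leqnn r); rewrite (qpair_diag K0) // sub0r.
  by move/qspanN; rewrite opprK.
have ss : sorted gtn s'.
  rewrite gtn_sorted_uniq_geq us; apply: sort_sorted => a b.
  exact: leq_total.
have sSP : s' \in SP n.
  rewrite mem_SP /strict_partition_of ss sd' eqxx andbT /=.
  by apply/allP => r; rewrite mem_sort mem_filter => /andP[].
have [c c0 [_ Hc]] := leading_qpf ss.
rewrite -[qprod _](scalerK c0); apply: QspanZ.
rewrite -[_ *: _](subKr (qpf q s')); apply: QspanD; first exact: Qspan_qpf.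
rewrite -scaleN1r; apply: QspanZ; apply: IH; rewrite -sd'.
by apply: qspanW Hc; rewrite ltnS.
Qed.

(** The last term of Newton's identity for $q_{2i+1}$ is $2x_iq_0$, so the identity can be solved
    for $x_i$ by induction. *)
Lemma qspan_x i : qspan i.*2.+1 0%N (x i).
Proof.
elim/ltn_ind: i => i IH.
have := qseq_newton K0 x i.*2; rewrite big_ord_recr /= subnn qseq0 mulr1.
rewrite {2}/dlog odd_double doubleK => E.
have -> : x i = (2%:R^-1 : K) *: (q i.*2.+1 *+ i.*2.+1
                   - \sum_(j < i.*2) dlog x j * q (i.*2 - j)%N).
  by rewrite E [X in X - _]addrC addrK -scaler_nat scalerA mulVf ?pnatr_eq0 ?scale1r.
apply: qspanZ; apply: qspanB.
  apply: qspanMn; have := @qspan_qprod [:: i.*2.+1] 0%N isT.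
  by rewrite /= addn0 /qprod big_seq1.
apply: qspan_sum => -[j /= ji] _.
have -> : (i.*2.+1 = j.+1 + (i.*2 - j))%N by lia.
apply: (@qspanM _ 0%N _ 0%N).
  rewrite /dlog; case: ifP => oj; first by constructor.
  apply: qspanMn; have -> : (j = j./2.*2)%N by lia.
  by rewrite doubleK; apply: IH; lia.
have := @qspan_qprod [:: (i.*2 - j)%N] 0%N isT.
by rewrite /= addn0 /qprod big_seq1.
Qed.

End Span.

(** * Linear independence *)

Section BinarySums.

Lemma sum_expn2 (s : seq nat) :
  (\sum_(b <- s) 2 ^ b = count_mem 0%N s +
     (\sum_(b <- [seq b.-1 | b <- s & (0 < b)%N]) 2 ^ b).*2)%N.
Proof.
elim: s => [|b s IH] /=; first by rewrite !big_nil.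
rewrite big_cons IH; case: b => [|b] /=; first by rewrite addnA.
by rewrite big_cons expnS /=; lia.
Qed.

(** Uniqueness of binary expansions: membership of $a$ is the digit of $2^a$. The induction strips
    the lowest digit by [sum_expn2]. *)
Lemma mem_sum_expn2 (s : seq nat) a : uniq s ->
  (a \in s) = odd ((\sum_(b <- s) 2 ^ b) %/ 2 ^ a)%N.
Proof.
elim: a s => [|a IH] s us.
  rewrite divn1 sum_expn2 oddD odd_double addbF count_uniq_mem //.
  by case: (_ \in _).
have -> : (a.+1 \in s) = (a \in [seq b.-1 | b <- s & (0 < b)%N]).
  apply/idP/mapP => [sa|[[|b]]]; first by exists a.+1; rewrite ?mem_filter.
    by rewrite mem_filter.
  by rewrite mem_filter /= => sb ->.
rewrite IH ?map_inj_in_uniq ?filter_uniq // => [|b c]; last first.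
  by rewrite !mem_filter => /andP[b0 _] /andP[c0 _]; lia.
rewrite (sum_expn2 s) expnS divnMA count_uniq_mem //; congr (odd (_ %/ _)).
by case: (0%N \in s); lia.
Qed.

End BinarySums.

(** * Glaisher's bijection and the coefficient matrix *)

Section Glaisher.

Definition odd_index (r : nat) : nat := (r %/ 2 ^ logn 2 r)./2.

Lemma odd_indexE r : (0 < r)%N -> r = (2 ^ logn 2 r * (odd_index r).*2.+1)%N.
Proof.
move=> r0; have dv := pfactor_dvdnn 2 r.
rewrite /odd_index.
have -> : (((r %/ 2 ^ logn 2 r)./2).*2.+1 = r %/ 2 ^ logn 2 r)%N.
  rewrite -[RHS]odd_double_half.
  suff -> : odd (r %/ 2 ^ logn 2 r) by [].
  have := pfactor_coprime (p := 2) isT r0; case=> k ck rE.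
  by rewrite {1}rE mulnK ?expn_gt0 // -coprime2n.
by rewrite mulnC divnK.
Qed.

(* Glaisher's map: a part 2^a (2 i + 1) contributes p_{2 i + 1} ^ (2 ^ a). *)
Definition glaisher (lam : seq nat) : {cmonom nat} :=
  \big[mmul/mone]_(r <- lam)
    iter (2 ^ logn 2 r) (mmul (ucm (odd_index r))) mone.

Lemma glaisherE lam i :
  glaisher lam i =
  (\sum_(a <- [seq logn 2 r | r <- lam & odd_index r == i]) 2 ^ a)%N.
Proof.
rewrite /glaisher cm_bigE big_map big_filter [RHS]big_mkcond.
by apply: eq_bigr => r _; rewrite iter_ucmE; case: ifP; rewrite ?mul1n ?mul0n.
Qed.

(** Distinct parts $2^a(2i+1)$ with the same $i$ have distinct $a$, so the binary digits of the
    exponent of $p_{2i+1}$ recover them. *)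
Lemma mem_glaisher lam r : uniq lam -> all (leq 1) lam -> (0 < r)%N ->
  (r \in lam) = odd (glaisher lam (odd_index r) %/ 2 ^ logn 2 r).
Proof.
move=> ul pl r0; rewrite glaisherE -mem_sum_expn2; last first.
  rewrite map_inj_in_uniq ?filter_uniq // => a b; rewrite !mem_filter.
  move=> /andP[/eqP ia /(allP pl) a0] /andP[/eqP ib /(allP pl) b0] E.
  by rewrite (odd_indexE a0) (odd_indexE b0) ia ib E.
apply/idP/mapP => [rl|[a]]; first by exists r; rewrite // mem_filter eqxx.
rewrite mem_filter => /andP[/eqP ia /[dup] al /(allP pl) a0] E.
by rewrite (odd_indexE r0) E -ia -odd_indexE.
Qed.

Lemma glaisher_inj n : {in SP n &, injective glaisher}.
Proof.
have gtnT : transitive gtn by move=> y x z /= xy yz; exact: ltn_trans yz xy.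
have irr : irreflexive gtn by move=> y; rewrite /= ltnn.
move=> lam mu; rewrite !mem_SP => /and3P[sl pl _] /and3P[sm pm _] E.
apply: (irr_sorted_eq gtnT irr) => // r.
have [->|r0] := posnP r.
  by apply/idP/idP => [/(allP pl)|/(allP pm)].
by rewrite !mem_glaisher ?E // (sorted_uniq gtnT irr).
Qed.

Lemma gmon_glaisher K lam :
  gmon K (glaisher lam) =
  \prod_(r <- lam) podd K (odd_index r) ^+ (2 ^ logn 2 r).
Proof.
by rewrite /glaisher gmon_prod; apply: eq_bigr => r _; rewrite gmon_iter.
Qed.

Lemma qspan_glaisher (K : numFieldType) (A : comAlgType K) (x : nat -> A) lam :
  all (leq 1) lam ->
  qspan x (sumn lam) 0%N (\prod_(r <- lam) x (odd_index r) ^+ (2 ^ logn 2 r)).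
Proof.
elim: lam => [_|r lam IH /= /andP[r0 pl]]; first by rewrite big_nil; apply: qspan1.
rewrite big_cons; apply: (@qspanM _ _ _ _ 0%N _ 0%N); last exact: IH.
rewrite {1}(odd_indexE r0); elim: (2 ^ _)%N => [|e IHe].
  by rewrite mul0n expr0; apply: qspan1.
rewrite mulSn exprS; apply: (@qspanM _ _ _ _ 0%N _ 0%N) => //; exact: qspan_x.
Qed.

Lemma Qspan_glaisher (K : numFieldType) n lam : lam \in SP n ->
  Qspan (podd K) n (gmon K (glaisher lam)).
Proof.
rewrite mem_SP gmon_glaisher => /and3P[_ pl /eqP <-].
exact/qspan_Qspan/qspan_glaisher.
Qed.

(** Expanding the distinct Glaisher monomials in the $Q_\mu$ gives a left inverse of the coefficient
    matrix. The matrix is square, so the inverse is two-sided. *)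
Lemma Qfun_glaisher_inverse n : exists B : seq nat -> seq nat -> rat,
  {in SP n &, forall mu nu,
    \sum_(rho <- SP n) gcoef (glaisher rho) (Qfun rat mu) * B rho nu
    = (mu == nu)%:R}.
Proof.
pose N := size (SP n); pose sp (i : 'I_N) := nth [::] (SP n) i.
have spP i : sp i \in SP n by apply: mem_nth.
have spI : injective sp.
  move=> i j /eqP; rewrite nth_uniq ?uniq_SP // => /eqP; exact: val_inj.
have /fin_all_exists[f Hf] : forall i : 'I_N, exists c : seq nat -> rat,
    gmon rat (glaisher (sp i)) = \sum_(mu <- SP n) c mu *: Qfun rat mu.
  by move=> i; apply: Qspan_glaisher.
have big_sp (F : seq nat -> rat) : \sum_(mu <- SP n) F mu = \sum_i F (sp i).
  by rewrite (big_nth [::]) big_mkord.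
pose M := \matrix_(i, j) gcoef (glaisher (sp j)) (Qfun rat (sp i)).
pose B := \matrix_(i, j) f i (sp j).
have BM : B *m M = 1%:M.
  apply/matrixP => i j; rewrite !mxE.
  have := congr1 (gcoef (glaisher (sp j))) (Hf i).
  rewrite gcoef_gmon gcoef_sum (inj_in_eq (@glaisher_inj n)) // (inj_eq spI).
  move=> ->; rewrite big_sp; apply: eq_bigr => k _; rewrite !mxE.
  exact/esym/gcoefZ.
pose Bf rho nu := if insub (index rho (SP n)) is Some i then f i nu else 0.
have BfE i nu : Bf (sp i) nu = f i nu.
  by rewrite /Bf index_uniq ?uniq_SP // valK.
exists Bf => mu nu /(nthP [::])[i iN <-] /(nthP [::])[j jN <-].
rewrite big_sp.
transitivity ((M *m B) (Ordinal iN) (Ordinal jN)).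
  by rewrite mxE; apply: eq_bigr => k _; rewrite !mxE BfE.
by rewrite (mulmx1C BM) mxE nth_uniq ?uniq_SP.
Qed.

(** The coefficients of an expansion in the $Q_\mu$ are determined, by a rational formula valid over
    every extension field. *)
Lemma Qfun_coefs_glaisher n (B : seq nat -> seq nat -> rat) :
  {in SP n &, forall mu nu,
    \sum_(rho <- SP n) gcoef (glaisher rho) (Qfun rat mu) * B rho nu
    = (mu == nu)%:R} ->
  forall (K : fieldType) (h : {rmorphism rat -> K}) (c : seq nat -> K) f,
  f = \sum_(mu <- SP n) c mu *: Qfun K mu ->
  {in SP n, forall nu,
    c nu = \sum_(rho <- SP n) gcoef (glaisher rho) f * h (B rho nu)}.
Proof.
move=> HB K h c f -> nu nun.
transitivity (\sum_(rho <- SP n) \sum_(mu <- SP n)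
    c mu * h (gcoef (glaisher rho) (Qfun rat mu) * B rho nu)); last first.
  apply: eq_bigr => rho _; rewrite gcoef_sum mulr_suml; apply: eq_bigr => mu _.
  rewrite rmorphM mulrA; congr (_ * _); apply/esym/(etrans (gcoefZ _ _ _)).
  by rewrite -(base_change_Qfun h) gcoef_base_change.
rewrite exchange_big /=.
transitivity (\sum_(mu <- SP n) c mu * (mu == nu)%:R).
  rewrite (bigD1_seq nu) ?uniq_SP //= eqxx mulr1 big1 ?addr0 // => mu /negPf->.
  by rewrite mulr0.
rewrite big_seq [RHS]big_seq; apply: eq_bigr => mu mun.
by rewrite -mulr_sumr -rmorph_sum HB // rmorph_nat.
Qed.

End Glaisher.

(** * The transition coefficients of a single row *)

Section TwoRows.
Variables (K : fieldType) (A : comAlgType K).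
Hypothesis K0 : [pchar K] =i pred0.

(** Both permutations of the two indices contribute the same entry, and the normalization is
    $1/2$. *)
Lemma pfaff2 (M : 'M[A]_(1.*2)) : M ord_max ord0 = - M ord0 ord_max ->
  pfaff M = M ord0 ord_max.
Proof.
move=> MN; rewrite /pfaff (eq_bigr (fun=> M ord0 ord_max)) => [|sg _].
  rewrite sumr_const card_Sn -scaler_nat scalerA mulVf ?scale1r //.
  by rewrite ((pcharf0P K).1 K0).
rewrite big_ord1.
have -> : ord_fst (ord0 : 'I_1) = ord0 by apply: val_inj.
have -> : ord_snd (ord0 : 'I_1) = ord_max by apply: val_inj.
have ord2 (y : 'I_(1.*2)) : y = ord0 \/ y = ord_max.
  by case: y => -[|[|//]] p; [left|right]; apply: val_inj.
have sgE : sg = (if sg ord0 == ord0 then 1 else tperm ord0 ord_max)%g.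
  have : sg ord0 != sg ord_max by rewrite (inj_eq perm_inj).
  case: (ord2 (sg ord0)) => E0; case: (ord2 (sg ord_max)) => E1;
    rewrite E0 E1 //= => _;
  by apply/permP => y; case: (ord2 y) => ->; rewrite ?perm1 ?tpermL ?tpermR.
rewrite sgE; case: ifP => _; first by rewrite odd_perm1 !perm1 expr0 mul1r.
by rewrite odd_tperm /= expr1 tpermL tpermR MN mulN1r opprK.
Qed.

(** Strict partitions have no zero part, hence the separate case; the padding of the Pfaffian
    restores it. *)
Definition two_rows (n b : nat) : seq nat :=
  if b == 0%N then [:: n] else [:: (n - b)%N; b].

Lemma qpf_two_rowsE (q : nat -> A) n b : qpf q (two_rows n b) = qpair q (n - b) b.
Proof.
rewrite /two_rows; case: eqP => [->|_]; rewrite /qpf pfaff2 !mxE //= subn0 //.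
Qed.

End TwoRows.

Lemma two_rows_inj n b b' : two_rows n b = two_rows n b' -> b = b'.
Proof. by rewrite /two_rows; case: eqP => [->|]; case: eqP => // _ _ []. Qed.

Lemma two_rows_SP n b : (b.*2 < n)%N -> two_rows n b \in SP n.
Proof.
move=> bn; rewrite mem_SP /strict_partition_of /two_rows.
by case: eqVneq => b0; rewrite /= ?addn0 ?eqxx; lia.
Qed.

(** * Fractions and their values at $(t^2,t)$ *)

Section Fractions.
Variable R : idomainType.
Implicit Types P D : R.

Lemma tofrac_addf_div P D P' D' : D != 0 -> D' != 0 ->
  tofrac P / tofrac D + tofrac P' / tofrac D'
  = tofrac (P * D' + P' * D) / tofrac (D * D').
Proof.
by move=> D0 D'0; rewrite addf_div ?tofrac_eq0 // tofracD !tofracM.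
Qed.

Lemma tofrac_mulf_div P D P' D' :
  tofrac P / tofrac D * (tofrac P' / tofrac D')
  = tofrac (P * P') / tofrac (D * D').
Proof. by rewrite mulf_div !tofracM. Qed.

End Fractions.

Section Specialization.

Definition rat_Qt : {rmorphism rat -> Qt} := @tofrac {poly rat} \o @polyC rat.
Definition rat_Qts : {rmorphism rat -> Qts} :=
  @tofrac {poly {poly rat}} \o (@polyC {poly rat} \o @polyC rat).

Fact subst_t2_t_is_zmod_morphism : zmod_morphism subst_t2_t.
Proof. by move=> p q; rewrite /subst_t2_t rmorphB hornerD hornerN. Qed.

Fact subst_t2_t_is_monoid_morphism : monoid_morphism subst_t2_t.
Proof.
by split=> [|p q]; rewrite /subst_t2_t ?rmorph1 ?hornerC // rmorphM hornerM.
Qed.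

HB.instance Definition _ := GRing.isZmodMorphism.Build
  {poly {poly rat}} {poly rat} subst_t2_t subst_t2_t_is_zmod_morphism.
HB.instance Definition _ := GRing.isMonoidMorphism.Build
  {poly {poly rat}} {poly rat} subst_t2_t subst_t2_t_is_monoid_morphism.

Lemma subst_t2_tM p q : subst_t2_t (p * q) = subst_t2_t p * subst_t2_t q.
Proof. exact: rmorphM. Qed.

Lemma subst_t2_tD p q : subst_t2_t (p + q) = subst_t2_t p + subst_t2_t q.
Proof. exact: rmorphD. Qed.

Lemma is_value_tofrac P : is_value_t2_t (tofrac P) (tofrac (subst_t2_t P)).
Proof. by exists P, 1; rewrite !rmorph1 !divr1 oner_neq0. Qed.

Lemma subst_t2_t_neq0 P : subst_t2_t P != 0 -> P != 0.
Proof. by apply: contraNneq => ->; rewrite rmorph0. Qed.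

Lemma is_valueD r v r' v' : is_value_t2_t r v -> is_value_t2_t r' v' ->
  is_value_t2_t (r + r') (v + v').
Proof.
move=> [P [D [D0 -> ->]]] [P' [D' [D'0 -> ->]]].
exists (P * D' + P' * D), (D * D'); split; first by rewrite subst_t2_tM mulf_neq0.
  by apply: tofrac_addf_div; apply: subst_t2_t_neq0.
by rewrite subst_t2_tD !subst_t2_tM; apply: tofrac_addf_div.
Qed.

Lemma is_valueM r v r' v' : is_value_t2_t r v -> is_value_t2_t r' v' ->
  is_value_t2_t (r * r') (v * v').
Proof.
move=> [P [D [D0 -> ->]]] [P' [D' [D'0 -> ->]]].
exists (P * P'), (D * D'); split; first by rewrite subst_t2_tM mulf_neq0.
  exact: tofrac_mulf_div.
by rewrite !subst_t2_tM; apply: tofrac_mulf_div.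
Qed.

(** A nonzero value means that the numerator survives the substitution, so it may become a
    denominator. *)
Lemma is_valueV r v : v != 0 -> is_value_t2_t r v -> is_value_t2_t r^-1 v^-1.
Proof.
move=> + [P [D [D0 -> vE]]]; rewrite vE => v0.
exists D, P; rewrite !invf_div; split=> //.
by apply: contraNneq v0 => ->; rewrite rmorph0 mul0r.
Qed.

Lemma is_value1 : is_value_t2_t 1 1.
Proof. by have := is_value_tofrac 1; rewrite !rmorph1. Qed.

Lemma is_value0 : is_value_t2_t 0 0.
Proof. by have := is_value_tofrac 0; rewrite !rmorph0. Qed.

Lemma is_valueX r v n : is_value_t2_t r v -> is_value_t2_t (r ^+ n) (v ^+ n).
Proof.
move=> H; elim: n => [|n IH]; first by rewrite !expr0; apply: is_value1.
by rewrite !exprS; apply: is_valueM.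
Qed.

Lemma is_value_rat c : is_value_t2_t (rat_Qts c) (rat_Qt c).
Proof.
have := is_value_tofrac c%:P%:P.
by rewrite /subst_t2_t map_polyC hornerC /= comp_polyC.
Qed.

Lemma is_value_sum (I : Type) (s : seq I) r v :
  (forall i, is_value_t2_t (r i) (v i)) ->
  is_value_t2_t (\sum_(i <- s) r i) (\sum_(i <- s) v i).
Proof.
by move=> H; apply: big_ind2 => //; [exact: is_value0 | exact: is_valueD].
Qed.

Lemma is_value_prod (I : Type) (s : seq I) r v :
  (forall i, is_value_t2_t (r i) (v i)) ->
  is_value_t2_t (\prod_(i <- s) r i) (\prod_(i <- s) v i).
Proof.
by move=> H; apply: big_ind2 => //; [exact: is_value1 | exact: is_valueM].
Qed.

Lemma value_t2_tP r v : is_value_t2_t r v -> value_t2_t r = v.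
Proof. by move=> [P [D [D0 -> ->]]]; apply: value_t2_tE. Qed.

Local Notation tt := (tofrac 'X : Qt).

Lemma tofracX_neq0 : tt != 0.
Proof. by rewrite tofrac_eq0 polyX_eq0. Qed.

Lemma one_sub_tX_neq0 k : 1 - tt ^+ k.+1 != 0.
Proof.
rewrite -rmorphXn -[1](rmorph1 (@tofrac {poly rat})) -rmorphB tofrac_eq0.
by rewrite -oppr_eq0 opprB monic_neq0 // monicXnsubC.
Qed.

Lemma is_value_factor k : is_value_t2_t
  ((1 - var_t ^+ k.+1) / (1 - var_s ^+ k.+1))
  ((1 - (tt ^+ 2) ^+ k.+1) / (1 - tt ^+ k.+1)).
Proof.
have sub1 r v : is_value_t2_t r v -> is_value_t2_t (1 - r) (1 - v).
  move=> H; apply: is_valueD; first exact: is_value1.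
  rewrite -mulN1r -[- v]mulN1r; apply: is_valueM => //.
  by have := is_value_tofrac (-1); rewrite !rmorphN1.
apply: is_valueM; last apply: is_valueV; rewrite ?one_sub_tX_neq0 //.
  apply/sub1/is_valueX; have := is_value_tofrac 'X%:P.
  by rewrite /subst_t2_t map_polyC hornerC /= comp_polyX rmorphXn.
apply/sub1/is_valueX; have := is_value_tofrac 'X.
by rewrite /subst_t2_t map_polyX hornerX.
Qed.

End Specialization.

(** * Expansion of the image of a single row *)

Section RowExpansion.
Variables (K : fieldType) (A : comAlgType K).
Hypothesis K0 : [pchar K] =i pred0.
Variables (x : nat -> A) (g : {rmorphism A -> A}) (t : K).
Hypothesis gx : forall i, g (x i) = (1 + t ^+ i.*2.+1) *: x i.

Lemma rmorph_row n : (0 < n)%N -> g (qpf (qseq x) [:: n]) =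
  \sum_(mu <- SP n)
    (\sum_(b < n.+1 | (b.*2 < n)%N) (mu == two_rows n b)%:R *
       (\sum_(a < n.+1) t ^+ a *+ qmult b (minn a (n - a))))
    *: qpf (qseq x) mu.
Proof.
move=> n0; rewrite -[ [:: n] ]/(two_rows n 0) (qpf_two_rowsE K0).
rewrite /qpair subn0 big_geq // mulr0 addr0 qseq0 mulr1.
rewrite (rmorph_qseq_qgeom K0 gx) (qgeomE K0 _ _ n0).
under [RHS]eq_bigr do rewrite scaler_suml.
rewrite exchange_big /=; apply: eq_bigr => b bn.
rewrite (bigD1_seq (two_rows n b)) ?two_rows_SP ?uniq_SP //= eqxx mul1r.
rewrite (qpf_two_rowsE K0) [X in _ + X]big1 ?addr0 // => mu /negPf->.
by rewrite mul0r scale0r.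
Qed.

End RowExpansion.

(** At $(t^2,t)$ the factors are $(1-t^{2k})/(1-t^k)=1+t^k$, so [rmorph_row] applies. *)
Lemma Tmap_row (K : fieldType) (t : K) n :
  [pchar K] =i pred0 -> (forall k, 1 - t ^+ k.+1 != 0) -> (0 < n)%N ->
  Tmap (t ^+ 2) t (Qfun K [:: n]) =
  \sum_(mu <- SP n)
    (\sum_(b < n.+1 | (b.*2 < n)%N) (mu == two_rows n b)%:R *
       (\sum_(a < n.+1) t ^+ a *+ qmult b (minn a (n - a))))
    *: Qfun K mu.
Proof.
move=> K0 t1.
have factorE k : (1 - (t ^+ 2) ^+ k.+1) / (1 - t ^+ k.+1) = 1 + t ^+ k.+1.
  rewrite exprAC (_ : 1 - _ ^+ 2 = (1 - t ^+ k.+1) * (1 + t ^+ k.+1)); last by ring.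
  by rewrite mulrC mulKf.
by apply: rmorph_row => // i; rewrite /Tmap psubst_podd factorE.
Qed.

Lemma gcoef_Tmap (K : fieldType) (a b : K) (h : {rmorphism rat -> K}) lam m :
  gcoef m (Tmap a b (Qfun K lam)) = h (gcoef m (Qfun rat lam)) *
    \prod_(i <- finsupp m) ((1 - a ^+ i.*2.+1) / (1 - b ^+ i.*2.+1)) ^+ m i.
Proof.
by rewrite /Tmap gcoef_psubst_scale -(base_change_Qfun h) gcoef_base_change.
Qed.

Section RowPolynomial.
Variables n b : nat.

(** For $2b<n$ this is $t^b+2t^{b+1}+\cdots+2t^{n-b-1}+t^{n-b}$. *)
Definition row_poly : {poly rat} :=
  \poly_(a < n.+1) (qmult b (minn a (n - a)))%:R.

Lemma coef_row_poly a : (a <= n)%N ->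
  row_poly`_a = (qmult b (minn a (n - a)))%:R.
Proof. by move=> an; rewrite coef_poly ltnS an. Qed.

Lemma row_poly_ge0 i : 0 <= row_poly`_i.
Proof. by rewrite coef_poly; case: ifP => // _; apply: ler0n. Qed.

Lemma tofrac_row_poly : tofrac row_poly =
  \sum_(a < n.+1) (tofrac 'X : Qt) ^+ a *+ qmult b (minn a (n - a)).
Proof.
rewrite /row_poly poly_def rmorph_sum; apply: eq_bigr => a _.
by rewrite scaler_nat rmorphMn rmorphXn.
Qed.

(** The coefficients depend only on $\min(a,n-a)$, which is invariant under $a\mapsto n-a$. *)
Lemma row_poly_palindromic : palindromic_of_darga n row_poly.
Proof.
rewrite /palindromic_of_darga tofrac_row_poly.
have -> : map_poly (fun c : rat => tofrac c%:P : Qt) row_poly =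
          map_poly rat_Qt row_poly.
  by [].
rewrite (horner_coef_wide (n := n.+1)); last first.
  by rewrite size_map_poly size_poly.
rewrite mulr_sumr (reindex_inj rev_ord_inj); apply: eq_bigr => -[a an] _.
have -> : (map_poly rat_Qt row_poly)`_(Ordinal an)
          = (qmult b (minn a (n - a)))%:R.
  rewrite coef_map coef_row_poly //; exact: (rmorph_nat rat_Qt).
rewrite mulrCA mulr_natl.
rewrite /= subSS subKn // minnC; congr (_ *+ _).
by rewrite exprVn exprB ?unitfE ?tofracX_neq0.
Qed.

(** [qmult b] is weakly increasing, and $\min(a,n-a)$ rises up to $\lfloor n/2\rfloor$ and then
    falls. *)
Lemma row_poly_unimodal : unimodal row_poly.
Proof.
have szn i : (i.+1 < size row_poly)%N -> (i.+1 <= n)%N.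
  by move=> /leq_trans/(_ (size_poly _ _)).
exists n./2; split=> i ik /szn szi; rewrite !coef_row_poly ?(ltnW szi) // ler_nat;
  rewrite /qmult; lia.
Qed.

End RowPolynomial.

Theorem corollary5p3 (n : nat) (hn : (1 <= n)%N)
    (C : seq nat -> seq nat -> Qts)
    (hC : transition_coefs n var_t var_s C)
    (mu : seq nat) (hmu : mu \in SP n) :
  value_t2_t (C [:: n] mu) != 0 ->
  exists f : {poly rat},
    [/\ value_t2_t (C [:: n] mu) = tofrac f,
        (forall i, 0 <= f`_i),
        palindromic f
      & unimodal f].
Proof.
have [B HB] := Qfun_glaisher_inverse n.
have Qt0 : [pchar Qt] =i pred0.
  by apply/pcharf0P => m; rewrite -(rmorph_nat rat_Qt) fmorph_eq0 pnatr_eq0.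
have rowSP : [:: n] \in SP n by apply: (@two_rows_SP n 0).
have -> : value_t2_t (C [:: n] mu) =
    \sum_(b < n.+1 | (b.*2 < n)%N) (mu == two_rows n b)%:R * tofrac (row_poly n b).
  apply: value_t2_tP.
  under eq_bigr do rewrite tofrac_row_poly.
  (* The same [B] reads off the coefficient over [Qts] and, from the explicit row expansion, over
     [Qt]. The two formulas are then compared factor by factor. *)
  rewrite (Qfun_coefs_glaisher HB rat_Qts (hC _ rowSP) hmu).
  rewrite (Qfun_coefs_glaisher HB rat_Qt (Tmap_row Qt0 one_sub_tX_neq0 hn) hmu).
  apply: is_value_sum => rho; apply: is_valueM; last exact: is_value_rat.
  rewrite (gcoef_Tmap _ _ rat_Qts) (gcoef_Tmap _ _ rat_Qt).
  apply: is_valueM; first exact: is_value_rat.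
  by apply: is_value_prod => i; apply/is_valueX/is_value_factor.
(* Either [mu] is a two-row partition for exactly one [b], or the sum vanishes, against the
   hypothesis. *)
have [/existsP[b /andP[bn /eqP muE]]|/existsPn nb] :=
    boolP [exists b : 'I_n.+1, (b.*2 < n)%N && (mu == two_rows n b)].
  rewrite (bigD1 b) //= muE eqxx mul1r big1 ?addr0 => [_|b' /andP[_ bb']].
    exists (row_poly n b).
    split=> //; [exact: row_poly_ge0 | | exact: row_poly_unimodal].
    by exists n; apply: row_poly_palindromic.
  case: eqP => [/two_rows_inj/val_inj E|_]; last by rewrite mul0r.
  by rewrite E eqxx in bb'.
rewrite big1 ?eqxx // => b bn; have := nb b; rewrite bn /= => /negPf->.
exact: mul0r.
Qed.
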